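(* Let $\rho_4=\frac{999991742359}{10^{12}}$ (so $\rho_4<1$). Let $n\ge 10$ and let $A$ be an $n\times n$ complex Hermitian positive semidefinite matrix with $\operatorname{rank} A\le 4$. Then $$\operatorname{per}(A\circ\overline A)\le \rho_4\,\operatorname{per}(A)^2 .$$ If $A$ has a zero diagonal entry, then $\operatorname{per}(A\circ\overline A)=0$ and $\operatorname{per}(A)^2=0$. If all diagonal entries of $A$ are positive, then $\operatorname{per}A>0$. Moreover, for any two $n\times n$ complex Hermitian positive semidefinite matrices $A,B$ (same order $n\ge 10$), both of rank at most four, $$\operatorname{per}(A\circ B)\le\rho_4\,\operatorname{per}(A)\,\operatorname{per}(B).$$
   Context: For an $n\times n$ complex matrix $A=(a_{ij})$, the permanent is $\operatorname{per}A=\sum_{\sigma\in S_n}\prod_{i=1}^n a_{i,\sigma(i)}$. The symbol $A\circ B$ denotes the entrywise (Hadamard) product and $\overline A$ the entrywise complex conjugate of $A$. *)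

(* Defs.v *)
From mathcomp Require Import all_boot all_order all_fingroup all_algebra.
From mathcomp Require Import complex reals.

Set Implicit Arguments.
Unset Strict Implicit.
Unset Printing Implicit Defensive.

Import Order.TTheory GRing.Theory Num.Theory.

Local Open Scope ring_scope.
Local Open Scope sesquilinear_scope.

Definition permanent (R : comNzRingType) (n : nat) (A : 'M[R]_n) : R :=
  \sum_(s : 'S_n) \prod_(i < n) A i (s i).

Definition hadamard (R : pzRingType) (m n : nat) (A B : 'M[R]_(m, n)) :
    'M[R]_(m, n) :=
  map2_mx *%R A B.

Definition psdmx (C : numClosedFieldType) (n : nat) (A : 'M[C]_n) : Prop :=
  A \is hermsymmx /\ forall x : 'cV[C]_n, 0 <= (x ^t* *m A *m x) 0 0.

(* 999991742359 / 10^12.  The numerator is spelled out in base 1000 because a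
   numeral in ring_scope expands to a unary natural number. *)
Definition rho4 (R : unitRingType) : R :=
  (999 * 1000 ^+ 3 + 991 * 1000 ^+ 2 + 742 * 1000 + 359) / 10 ^+ 12.

(* Main.v *)
Require Import Defs.
From mathcomp Require Import all_boot all_order all_fingroup all_algebra.
From mathcomp Require Import complex reals.
From mathcomp Require Import cyclic separable cyclotomic.
From mathcomp Require Import boolp functions.
From mathcomp Require Import topology normedtype sequences derive realfun exp.
From mathcomp Require Import ring lra zify.

(** Both parts reduce to one inequality for a positive semidefinite A of rank
at most four.  The permanent of A o B is the sum over permutations s of the
products of the two diagonal products, so Cauchy-Schwarz gives |per (A o B)|^2
<= per (A o conj A) per (B o conj B) ([nsq_permanent_hadamard]), and the mixed
inequality follows from per (A o conj A) <= rho4 (per A)^2 applied to A and to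
B.

For that inequality factor A as the Gram matrix of vectors in C^4
([psd_factor]).  A zero diagonal entry kills a row; otherwise both sides scale
alike when the vectors are normalised, so A may be taken to be the Gram matrix
of unit vectors u_1, ..., u_n of C^4.  Let C be the matrix of the overlaps
|<u_i, u_j>|^2 and q the mean of its row sums.  Rank four enters as n / 4 <= q
([total2_ge]): the frame operator has trace n and only four eigenvalues.  The
numbers per C and per A are compared through q.

Upper bound.  The entries of C lie in [0, 1], so Minc's inequality per C <=
prod_i minc (r_i), where minc is affine and r_i are the row sums, holds
([permanent_le_minc]); with the arithmetic-geometric mean inequality this
gives per C <= minc(q)^n.

Lower bound.  For x uniform on the unit sphere of C^4 and y_i = |<u_i, x>|^2,
Wick's formula reads E (prod_i y_i) = 6 / (n+3)! per A
([sphere_mean_prod_cvg]), and the same formula gives all the moments E (s^2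
y_i^m), where s = sum_i y_i ([sphere_lim_intensity2]).  Jensen's inequality
for the probability with density s^2 / E (s^2), applied to the exponential of
sum_i ln y_i - 2 ln s, bounds E (prod_i y_i) from below in terms of the row
sums of C and of the diagonal of A^3 ([permanent_lower]).  Uniform density
would give a bound independent of q; the weight s^2 makes the bound increase
with q, as minc(q)^n does.  The cube is eliminated by Cauchy-Schwarz
([sqr_degree_le]), and the result is [permanent_gram_ge].

Comparison.  It remains that minc(q)^n <= rho4 permanent_bound(n, q)^2
([minc_le_permanent_bound]).  For a fixed ratio q / n the quotient of the left
side by the right one decreases with n, so n = 10 decides; there the worst
ratio is 1 / 4, the case of a tight frame, and the claim becomes a numerical
inequality between a power of e and rationals ([base_constant]). *)

Set Implicit Arguments.
Unset Strict Implicit.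
Unset Printing Implicit Defensive.

Import Order.TTheory GRing.Theory Num.Theory.
Import numFieldNormedType.Exports.

Local Open Scope ring_scope.

(** * Permanents *)
Section Permanent.
Variable R : comNzRingType.

Lemma lift_perm_inj n (i j : 'I_n.+1) : injective (lift_perm i j).
Proof.
move=> s t st; apply/permP => k; apply: (@lift_inj _ j).
by rewrite -!(lift_perm_lift i) st.
Qed.

Lemma mem_lift_perm n (i j : 'I_n.+1) (s : 'S_n.+1) :
  (s \in lift_perm i j @: [set: 'S_n]) = (s i == j).
Proof.
apply/imsetP/eqP => [[t _ ->]|sij]; first exact: lift_perm_id.
have lift_s k : {k' | s (lift i k) = lift j k'}.
  case: (unliftP j (s (lift i k))) => [k' ->|]; first by exists k'.
  by rewrite -sij => /perm_inj/eqP; rewrite eq_sym (negPf (neq_lift i k)).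
have t_inj : injective (fun k => sval (lift_s k)).
  move=> k l kl; apply: (@lift_inj _ i); apply: (@perm_inj _ s).
  by rewrite (svalP (lift_s k)) (svalP (lift_s l)) kl.
exists (perm t_inj); rewrite ?inE //; apply/permP => k.
case: (unliftP i k) => [l|] ->; last by rewrite lift_perm_id.
by rewrite lift_perm_lift permE; exact: (svalP (lift_s l)).
Qed.

Lemma mul_permanent_minor n (A : 'M[R]_n) i j :
  A i j * permanent (row' i (col' j A)) =
    \sum_(s : 'S_n | s i == j) \prod_k A k (s k).
Proof.
case: n A i j => [|n] A i j; first by case: i.
rewrite -(eq_bigl _ _ (mem_lift_perm i j)) big_imset /=; last first.
  by move=> s t _ _; exact: lift_perm_inj.
rewrite mulr_sumr; apply: eq_big => [s|s _]; first by rewrite inE.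
rewrite [RHS](bigD1_ord i (P := xpredT)) //= lift_perm_id; congr (_ * _).
by apply: eq_bigr => k _; rewrite !mxE lift_perm_lift.
Qed.

Lemma permanent_expand_row n (A : 'M[R]_n) i :
  permanent A = \sum_j A i j * permanent (row' i (col' j A)).
Proof.
rewrite /permanent (partition_big (fun s : 'S_n => s i) predT) //=.
by apply: eq_bigr => j _; rewrite mul_permanent_minor.
Qed.

(** The weight A i j * permanent (minor i j) collects the permutations sending
i to j: an average over columns with these weights is an average over
permutations. *)
Lemma permanent_sum_row n (A : 'M[R]_n) i (F : 'I_n -> R) :
  \sum_j A i j * permanent (row' i (col' j A)) * F j =
  \sum_(s : 'S_n) (\prod_k A k (s k)) * F (s i).
Proof.
rewrite [RHS](partition_big (fun s : 'S_n => s i) predT) //=.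
apply: eq_bigr => j _; rewrite mul_permanent_minor mulr_suml.
by apply: eq_bigr => s /eqP ->.
Qed.

Lemma permanent_tr n (A : 'M[R]_n) : permanent A^T = permanent A.
Proof.
rewrite /permanent (reindex_inj (@invg_inj _)) /=.
apply: eq_bigr => s _; rewrite (reindex_inj (@perm_inj _ s)) /=.
by apply: eq_bigr => i _; rewrite mxE permK.
Qed.

Lemma permanent_scale n (A : 'M[R]_n) (d e : 'I_n -> R) :
  permanent (\matrix_(i, j) (d i * A i j * e j)) =
  (\prod_i d i) * permanent A * \prod_i e i.
Proof.
rewrite /permanent mulr_sumr mulr_suml; apply: eq_bigr => s _.
transitivity (\prod_i (d i * A i (s i) * e (s i))).
  by apply: eq_bigr => i _; rewrite mxE.
rewrite !big_split /=; congr (_ * _).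
by rewrite [RHS](reindex_inj (@perm_inj _ s)).
Qed.

Lemma permanent_row0 n (A : 'M[R]_n) i :
  (forall j, A i j = 0) -> permanent A = 0.
Proof.
by move=> A0; rewrite (permanent_expand_row A i) big1 // => j _; rewrite A0 mul0r.
Qed.

Lemma permanent_same_rows n (r : 'I_n -> R) :
  permanent (\matrix_(i < n, j < n) r j) = n`!%:R * \prod_j r j.
Proof.
transitivity (\sum_(s : 'S_n) \prod_j r j); last first.
  by rewrite sumr_const card_Sn mulr_natl.
apply: eq_bigr => s _; rewrite [RHS](reindex_inj (@perm_inj _ s)) /=.
by apply: eq_bigr => i _; rewrite mxE.
Qed.

End Permanent.

Lemma map_permanent (R S : comNzRingType) (f : {rmorphism R -> S}) n
    (A : 'M[R]_n) :
  permanent (map_mx f A) = f (permanent A).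
Proof.
rewrite /permanent rmorph_sum; apply: eq_bigr => s _.
by rewrite rmorph_prod; apply: eq_bigr => i _; rewrite mxE.
Qed.

(** * Minc's bound *)
Section Minc.
Variable R : realType.

(** Minc's affine factor 1 + b (x - 1), with b = 29 / 70 a rational slightly
above sqrt 2 - 1, the least slope for which the bound is true. *)
Definition minc (x : R) : R := 41 / 70 + 29 / 70 * x.

Lemma minc_gt0 x : 0 <= x -> 0 < minc x.
Proof. rewrite /minc; lra. Qed.

Lemma bernoulli2 (x : R) m : 0 <= x ->
  1 + m%:R * x + m%:R * (m%:R - 1) / 2 * x ^+ 2 <= (1 + x) ^+ m.
Proof.
move=> x0; elim: m => [|m IH]; first by rewrite !mul0r !addr0 expr0.
have x1 : 0 <= 1 + x by lra.
rewrite [(1 + x) ^+ _]exprS; apply: (le_trans _ (ler_wpM2l x1 IH)).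
rewrite -natr1; have m0 : 0 <= m%:R * (m%:R - 1) :> R.
  case: m {IH} => [|m]; first by rewrite mul0r.
  by rewrite -[m.+1%:R]natr1 addrK mulr_ge0 // addr_ge0.
have x3 : 0 <= x ^+ 3 by rewrite exprn_ge0.
by have := mulr_ge0 m0 x3; nra.
Qed.

(** This inequality drives the induction in Minc's bound.  The terms of
degree at most two of the binomial expansion of (1 + b / minc m)^m already
give it.  For m = 0 it is an equality and for m = 1 it reads
2 <= (1 + b)^2, which is what dictates the slope b of minc. *)
Lemma minc_step m : m.+1%:R * minc m%:R ^+ m <= minc m.+1%:R ^+ m.+1.
Proof.
case: m => [|m]; first by rewrite /minc expr0 expr1; lra.
set M := m.+1; have M1 : 1 <= M%:R :> R by rewrite ler1n.
have g0 : 0 < minc M%:R by rewrite minc_gt0.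
have -> : minc M.+1%:R = minc M%:R * (1 + 29 / 70 / minc M%:R).
  by rewrite mulrDr mulr1 mulrCA mulfV ?lt0r_neq0 // mulr1 /minc -natr1; lra.
set x := 29 / 70 / minc M%:R; set g := minc M%:R in g0 x *.
have x0 : 0 <= x by apply: divr_ge0; [lra | apply: ltW].
have -> : (g * (1 + x)) ^+ M.+1 = g ^+ M * ((1 + x) ^+ M * ((1 + x) * g)).
  by rewrite exprMn (exprS g M) (exprS (1 + x) M); ring.
rewrite mulrC; apply: ler_wpM2l; first by rewrite exprn_ge0 // ltW.
have y0 : 0 <= (1 + x) * g by apply: mulr_ge0; [apply: addr_ge0 | apply: ltW].
apply: (le_trans _ (ler_wpM2r y0 (bernoulli2 M x0))).
rewrite /x /g {x g g0 x0 y0}.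
rewrite /minc -natr1; move: (M%:R : R) M1 => x x1 {M}.
have g0 : 0 < 41 / 70 + 29 / 70 * x by lra.
rewrite -(ler_pM2r (exprn_gt0 2 g0)).
set g := (41 / 70 + 29 / 70 * x).
have -> : (1 + x * (29 / 70 / g) + x * (x - 1) / 2 * (29 / 70 / g) ^+ 2) *
  ((1 + 29 / 70 / g) * g) * g ^+ 2 =
  (g ^+ 2 + x * (29 / 70) * g + x * (x - 1) / 2 * (29 / 70) ^+ 2) * (g + 29 / 70).
  by field; rewrite /g; lra.
rewrite {}/g; have [t t0 ->] : exists2 t, 0 <= t & x = t + 1.
  by exists (x - 1); [rewrite subr_ge0 | rewrite subrK].
have := exprn_ge0 2 t0; have := exprn_ge0 3 t0; lra.
Qed.

Lemma minc_gt0n (m : nat) : 0 < minc m%:R.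
Proof. exact: minc_gt0. Qed.

Lemma ln_minc_step m :
  ln m.+1%:R + m%:R * ln (minc m%:R) <= m.+1%:R * ln (minc m.+1%:R).
Proof.
have g0 := minc_gt0n m; have g1 := minc_gt0n m.+1.
rewrite !mulr_natl -!lnXn // -lnM ?posrE ?exprn_gt0 //.
by rewrite ler_ln ?posrE ?mulr_gt0 ?exprn_gt0 // minc_step.
Qed.

(** Tangent line of the convex function p ln p at c. *)
Lemma xlnx_tangent (p c : R) : 0 <= p -> 0 < c -> p * ln c + p - c <= p * ln p.
Proof.
rewrite le0r => /predU1P[->|p0] c0; first by rewrite !mul0r; lra.
have : ln (c / p) <= c / p - 1.
  have := @le_ln1Dx R (c / p - 1); rewrite [1 + _]addrC subrK; apply.
  by have := divr_gt0 c0 p0; lra.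
rewrite ln_div ?posrE // => /(ler_wpM2l (ltW p0)).
rewrite !mulrBr mulr1 mulrCA divff ?gt_eqF // mulr1; lra.
Qed.

Definition indmx n (B : 'I_n -> 'I_n -> bool) : 'M[R]_n :=
  \matrix_(i, j) (B i j)%:R.

Lemma permanent_indmx_ge0 n (B : 'I_n -> 'I_n -> bool) :
  0 <= permanent (indmx B).
Proof.
by apply: sumr_ge0 => s _; apply: prodr_ge0 => i _; rewrite mxE ler0n.
Qed.

Lemma minor_indmx n (B : 'I_n.+1 -> 'I_n.+1 -> bool) i k :
  row' i (col' k (indmx B)) = indmx (fun a b => B (lift i a) (lift k b)).
Proof. by apply/matrixP => a b; rewrite !mxE. Qed.

Definition rowcount n (B : 'I_n -> 'I_n -> bool) i := (\sum_j B i j)%N.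

(** Schrijver's entropy inequality: the permanent P is the sum of r minors, r
being the row count, and by convexity of x ln x the sum of their Q ln Q is at
least r (P / r) ln (P / r). *)
Lemma permanent_row_entropy n (B : 'I_n -> 'I_n -> bool) i :
  permanent (indmx B) * ln (permanent (indmx B)) <=
    permanent (indmx B) * ln (rowcount B i)%:R +
    \sum_k indmx B i k * permanent (row' i (col' k (indmx B))) *
            ln (permanent (row' i (col' k (indmx B)))).
Proof.
set P := permanent (indmx B).
pose Q k := permanent (row' i (col' k (indmx B)));
rewrite -[X in _ + X]/(\sum_k indmx B i k * Q k * ln (Q k)).
have P_ge0 : 0 <= P by exact: permanent_indmx_ge0.
have Q_ge0 k : 0 <= Q k.
  apply: sumr_ge0 => s _; apply: prodr_ge0 => j _.
  by rewrite !mxE ler0n.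
have PE : P = \sum_k indmx B i k * Q k by exact: permanent_expand_row.
have [P0|Pn0] := eqVneq P 0.
  rewrite P0 !mul0r add0r; apply: sumr_ge0 => k _.
  have : indmx B i k * Q k == 0.
    move: PE; rewrite P0 => /esym/eqP; rewrite psumr_eq0; last first.
      by move=> k' _; rewrite mulr_ge0 // mxE ler0n.
    by move=> /allP/(_ k); rewrite mem_index_enum => /(_ isT).
  by move/eqP ->; rewrite mul0r.
have P_gt0 : 0 < P by rewrite lt_def Pn0.
pose r : R := (rowcount B i)%:R.
have rE : r = \sum_k indmx B i k.
  by rewrite /r /rowcount natr_sum; apply: eq_bigr => k _; rewrite mxE.
have r_gt0 : 0 < r.
  rewrite lt_def ler0n andbT; apply/eqP => r0.
  move/eqP: Pn0; apply; rewrite PE big1 // => k _.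
  suff -> : indmx B i k = 0 by rewrite mul0r.
  apply/eqP; move/esym/eqP: rE; rewrite r0 psumr_eq0; last first.
    by move=> k' _; rewrite mxE ler0n.
  by move=> /allP/(_ k); rewrite mem_index_enum => /(_ isT).
have c0 : 0 < P / r by rewrite divr_gt0.
(* The tangent is taken at the mean P / r of the minors. *)
have T k : indmx B i k * (Q k * ln (P / r) + Q k - P / r) <=
           indmx B i k * Q k * ln (Q k).
  by rewrite -mulrA ler_wpM2l ?xlnx_tangent // mxE ler0n.
rewrite -lerBlDl; apply: (le_trans _ (ler_sum _ (fun k _ => T k))).
rewrite (eq_bigr (fun k => indmx B i k * Q k * (ln (P / r) + 1) -
                          indmx B i k * (P / r))); last by move=> k _; ring.
rewrite sumrB -!mulr_suml -PE -rE ln_div ?posrE // -/r.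
by rewrite mulrCA mulfV ?gt_eqF // mulr1; lra.
Qed.

Lemma rowcount_minor n (B : 'I_n.+1 -> 'I_n.+1 -> bool) i k a :
  rowcount (fun a b => B (lift i a) (lift k b)) a =
  (rowcount B (lift i a) - B (lift i a) k)%N.
Proof.
rewrite /rowcount; set b := lift i a.
rewrite [in RHS](bigD1_ord k (P := xpredT)) //= addnC addnK.
by apply: eq_bigr.
Qed.

(** Contribution of a single row to the induction step.  Deleting a column
from a row of sum r leaves a sum r - 1 for r of the columns and r for the
others; one of the r columns, j0, is the one used by the permutation.  The
extra ln r is then absorbed by minc_step with m = r - 1. *)
Lemma sum_ln_minc_row n (b : 'I_n -> bool) (j0 : 'I_n) (r : nat) :
  b j0 -> r = (\sum_j b j)%N ->
  ln r%:R + (\sum_j ln (minc (r - b j)%:R) - ln (minc (r - b j0)%:R)) <=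
    n%:R * ln (minc r%:R).
Proof.
move=> bj0 rb.
have [m rE] : exists m, r = m.+1.
  exists r.-1; rewrite prednK // rb (bigD1 j0) //= bj0; lia.
set g1 := ln (minc r%:R); set g0 := ln (minc m%:R).
have sumE : \sum_j ln (minc (r - b j)%:R) = n%:R * g1 + r%:R * (g0 - g1).
  rewrite (eq_bigr (fun j => g1 + (b j)%:R * (g0 - g1))); last first.
    move=> j _; case: (b j); last by rewrite subn0 mul0r addr0.
    by rewrite rE subn1 /= mul1r addrC subrK.
  by rewrite big_split /= sumr_const card_ord mulr_natl -mulr_suml rb natr_sum.
rewrite sumE bj0 {2}rE subn1 /= -/g0.
have := ln_minc_step m; rewrite -rE -/g0 -/g1.
rewrite rE -[m.+1%:R]natr1 [m.+1.-1]/= -/g0; lra.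
Qed.

(** Schrijver's proof of the Minc-Bregman type bounds.  The entropy inequalities
of all the rows are added; the minors are bounded by induction on n, and for
each permutation s the logarithms of the row factors are regrouped by
rows, where sum_ln_minc_row applies.  The outcome is
n P ln P <= n P (sum of the ln (minc r_j)). *)
Theorem permanent_indmx_le n (B : 'I_n -> 'I_n -> bool) :
  permanent (indmx B) <= \prod_i minc (rowcount B i)%:R.
Proof.
elim: n B => [|n IH] B.
  rewrite big_ord0 /permanent (eq_bigr (fun=> 1)) => [|s _]; last first.
    by rewrite big_ord0.
  by rewrite sumr_const card_Sn.
set P := permanent _.
have P_ge0 : 0 <= P by exact: permanent_indmx_ge0.
have [P0|Pn0] := eqVneq P 0.
  by rewrite P0; apply: prodr_ge0 => i _; rewrite ltW // minc_gt0n.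
have P_gt0 : 0 < P by rewrite lt_def Pn0.
pose g j := ln (minc (rowcount B j)%:R).
suff lnP : ln P <= \sum_j g j.
  rewrite -[P]lnK ?posrE //; apply: le_trans (_ : expR (\sum_j g j) <= _).
    by rewrite ler_expR.
  rewrite expR_sum le_eqVlt; apply/orP; left; apply/eqP.
  by apply: eq_bigr => j _; rewrite lnK ?posrE // minc_gt0n.
pose W (s : 'S_n.+1) := \prod_k indmx B k (s k).
pose Q i k := permanent (row' i (col' k (indmx B))).
have PW : P = \sum_s W s by [].
have W_ge0 s : 0 <= W s by apply: prodr_ge0 => i _; rewrite mxE ler0n.
(* In the minor avoiding row i and column s i, each other row j has lost its
entry in the column s i. *)
have key s : W s * \sum_i ln (Q i (s i)) <=
    W s * \sum_j (n.+1%:R * g j - ln (rowcount B j)%:R).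
  have [->|Wn0] := eqVneq (W s) 0; first by rewrite !mul0r.
  rewrite ler_wpM2l //.
  have Bs j : B j (s j).
    have : indmx B j (s j) != 0 by move/prodf_neq0: Wn0; apply.
    by rewrite mxE; case: (B j (s j)); rewrite ?eqxx.
  pose F j k := ln (minc (rowcount B j - B j k)%:R).
  have lnQ i : ln (Q i (s i)) <= \sum_j F j (s i) - F i (s i).
    rewrite [X in X - _](bigD1_ord i (P := xpredT)) //= addrC addrK.
    have Q_gt0 : 0 < Q i (s i).
      have : 0 < indmx B i (s i) * Q i (s i).
        rewrite mul_permanent_minor (bigD1 s) //=.
        apply: ltr_pwDl; last by apply: sumr_ge0 => s' _; exact: W_ge0.
        by rewrite lt_def Wn0 /= W_ge0.
      by rewrite mxE Bs mul1r.
    rewrite -ler_expR lnK ?posrE // expR_sum /Q minor_indmx.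
    apply: (le_trans (IH _)); rewrite le_eqVlt; apply/orP; left; apply/eqP.
    apply: eq_bigr => a _; rewrite lnK ?posrE ?minc_gt0n //.
    by rewrite rowcount_minor.
  apply: (le_trans (ler_sum _ (fun i _ => lnQ i))).
  rewrite sumrB exchange_big /= -sumrB; apply: ler_sum => j _.
  rewrite lerBrDr addrC.
  have -> : \sum_i F j (s i) = \sum_k F j k.
    by rewrite [RHS](reindex_inj (@perm_inj _ s)).
  exact: (@sum_ln_minc_row _ (B j) (s j) _ (Bs j)).
have tot : n.+1%:R * (P * ln P) <=
    \sum_i P * ln (rowcount B i)%:R + \sum_s W s * \sum_i ln (Q i (s i)).
  have -> : n.+1%:R * (P * ln P) = \sum_(i < n.+1) P * ln P.
    by rewrite sumr_const card_ord mulr_natl.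
  have -> : \sum_s W s * \sum_i ln (Q i (s i)) =
      \sum_i \sum_k indmx B i k * Q i k * ln (Q i k).
    under [RHS]eq_bigr => i _ do rewrite permanent_sum_row.
    by rewrite exchange_big; apply: eq_bigr => s _; rewrite mulr_sumr.
  rewrite -big_split /=; apply: ler_sum => i _; exact: permanent_row_entropy.
have N0 : 0 < n.+1%:R * P by rewrite mulr_gt0.
rewrite -(ler_pM2l N0) -mulrA; apply: (le_trans tot).
apply: (le_trans (lerD (lexx _) (ler_sum _ (fun s _ => key s)))).
rewrite -mulr_suml -PW -mulr_sumr -mulrDr -big_split /=.
rewrite (eq_bigr (fun j => n.+1%:R * g j)); last by move=> j _; ring.
by rewrite -mulr_sumr; lra.
Qed.

End Minc.

Lemma permanent_affine_row (R : comNzRingType) n (A A0 A1 : 'M[R]_n) i a b :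
  (forall k l, k != i -> A0 k l = A k l) ->
  (forall k l, k != i -> A1 k l = A k l) ->
  (forall l, A i l = a * A0 i l + b * A1 i l) ->
  permanent A = a * permanent A0 + b * permanent A1.
Proof.
move=> E0 E1 E.
have minorE (A' : 'M[R]_n) : (forall k l, k != i -> A' k l = A k l) ->
    forall l, row' i (col' l A') = row' i (col' l A).
  move=> EA l; apply/matrixP => k m; rewrite !mxE EA //.
  by rewrite eq_sym neq_lift.
rewrite (permanent_expand_row A i) (permanent_expand_row A0 i).
rewrite (permanent_expand_row A1 i) !mulr_sumr -big_split /=.
by apply: eq_bigr => l _; rewrite !minorE // E mulrDl !mulrA.
Qed.

(** * Matrices with entries in [0, 1] *)
Section UnitEntries.
Variable R : realType.

Definition set_entry n (A : 'M[R]_n) i j t : 'M[R]_n :=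
  \matrix_(k, l) if (k == i) && (l == j) then t else A k l.

(** Both sides are affine functions of each single entry, so it suffices to
check the extreme values 0 and 1 of the entries; the induction is on the
number of entries that are neither. *)
Theorem permanent_le_minc n (A : 'M[R]_n) :
  (forall i j, 0 <= A i j <= 1) ->
  permanent A <= \prod_i minc (\sum_j A i j).
Proof.
pose frac (A : 'M[R]_n) := [set p : 'I_n * 'I_n | (A p.1 p.2 != 0) && (A p.1 p.2 != 1)].
have [N] := ubnP #|frac A|; elim: N A => // N IH A /ltnSE leN A01.
have [F0|[[i j]]] := set_0Vmem (frac A).
  have AE : A = indmx R (fun i j => A i j == 1).
    apply/matrixP => i j; rewrite mxE.
    have : (i, j) \notin frac A by rewrite F0 inE.
    rewrite inE /= negb_and !negbK => /orP[] /eqP -> //.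
      by rewrite eq_sym oner_eq0.
    by rewrite eqxx.
  rewrite {1}AE; apply: (le_trans (permanent_indmx_le _ _)).
  rewrite le_eqVlt; apply/orP; left; apply/eqP; apply: eq_bigr => i _.
  congr minc; rewrite /rowcount natr_sum; apply: eq_bigr => j _.
  by rewrite [in RHS]AE mxE.
rewrite inE /= => Aij; set t := A i j in Aij.
have /andP[t0 t1] : 0 <= t <= 1 by exact: A01.
have IHe (e : R) : (e == 0) || (e == 1) ->
    permanent (set_entry A i j e) <= \prod_k minc (\sum_l set_entry A i j e k l).
  move=> e01; apply: IH.
    apply: leq_trans leN; apply: proper_card; apply/properP; split.
      apply/fintype.subsetP => -[k l]; rewrite !inE /= !mxE.
      case: ifP => // /andP[/eqP-> /eqP->].
      by case/orP: e01 => /eqP->; rewrite eqxx ?andbF.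
    exists (i, j); first by rewrite inE.
    by rewrite !inE /= !mxE !eqxx /=; case/orP: e01 => ->; rewrite ?andbF.
  move=> k l; rewrite mxE; case: ifP => // _.
  by case/orP: e01 => /eqP->; rewrite ?lexx ler01.
have row_other e k : k != i -> \sum_l set_entry A i j e k l = \sum_l A k l.
  by move=> ki; apply: eq_bigr => l _; rewrite mxE (negPf ki).
have row_i e : \sum_l set_entry A i j e i l = \sum_l A i l - t + e.
  rewrite (bigD1 j) //= [in RHS](bigD1 j) //= mxE !eqxx /=.
  rewrite (eq_bigr (fun l => A i l)); first by rewrite -/t; ring.
  by move=> l lj; rewrite mxE (negPf lj) andbF.
have -> : permanent A = (1 - t) * permanent (set_entry A i j 0) +
                        t * permanent (set_entry A i j 1).
  apply: (@permanent_affine_row _ _ _ _ _ i).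
  - by move=> k l ki; rewrite mxE (negPf ki).
  - by move=> k l ki; rewrite mxE (negPf ki).
  move=> l; rewrite !mxE eqxx /=; case: eqP => [->|_]; last by ring.
  by rewrite -/t; ring.
have := IHe 0; rewrite eqxx => /(_ isT) H0.
have := IHe 1; rewrite eqxx orbT => /(_ isT) H1.
have t1' : 0 <= 1 - t by rewrite subr_ge0.
apply: (le_trans (lerD (ler_wpM2l t1' H0) (ler_wpM2l t0 H1))).
rewrite (bigD1 i) //= [X in _ + t * X](bigD1 i) //= [X in _ <= X](bigD1 i) //=.
rewrite !row_i.
have rest e : \prod_(k < n | k != i) minc (\sum_l set_entry A i j e k l) =
              \prod_(k < n | k != i) minc (\sum_l A k l).
  by apply: eq_bigr => k ki; rewrite row_other.
rewrite !rest !mulrA -mulrDl le_eqVlt; apply/orP; left; apply/eqP.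
by congr (_ * _); rewrite /minc; ring.
Qed.

Lemma prod_minc_le n (r : 'I_n -> R) : (0 < n)%N -> (forall i, 0 <= r i) ->
  \prod_i minc (r i) <= minc ((\sum_i r i) / n%:R) ^+ n.
Proof.
move=> n0 r0.
have H := @leif_AGM R _ xpredT (fun i => minc (r i))
  (fun i _ => ltW (minc_gt0 (r0 i))).
apply: (le_trans (H.1)); rewrite {H} card_ord.
rewrite le_eqVlt; apply/orP; left; apply/eqP; congr (_ ^+ _).
have n0' : n%:R != 0 :> R by rewrite pnatr_eq0 -lt0n.
rewrite /minc big_split /= sumr_const card_ord -mulr_sumr mulrDl.
by rewrite -[_ *+ n]mulr_natr mulfK // mulrA.
Qed.

Lemma permanent_le_minc_mean n (A : 'M[R]_n) : (0 < n)%N ->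
  (forall i j, 0 <= A i j <= 1) ->
  permanent A <= minc ((\sum_i \sum_j A i j) / n%:R) ^+ n.
Proof.
move=> n0 A01; apply: le_trans (permanent_le_minc A01) _.
apply: prod_minc_le => // i.
by apply: sumr_ge0 => j _; case/andP: (A01 i j).
Qed.

End UnitEntries.

(** * Permanents of colour matching matrices *)
Section Counting.
Variable T : finType.

Definition fiber M (f : 'I_M -> T) (k : T) := (\sum_i (f i == k))%N.

Lemma fiber_lift M (f : 'I_M.+1 -> T) j k :
  fiber f k = ((f j == k) + fiber (f \o lift j) k)%N.
Proof. by rewrite /fiber (bigD1_ord j (P := xpredT)). Qed.

(** The permutations matching two colourings f and g exist when all colour
classes have the same sizes, and then they are products of bijections between
the classes, counted by factorials.  These factorials become the moments of
the sphere. *)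
Lemma permanent_match (S : comNzRingType) M (f g : 'I_M -> T) :
  permanent (\matrix_(i, j) ((f j == g i)%:R : S)) =
  [forall k, fiber f k == fiber g k]%:R * \prod_k ((fiber f k)`!)%:R.
Proof.
elim: M f g => [|M IH] f g.
  have f0 (h : 'I_0 -> T) k : fiber h k = 0%N by rewrite /fiber big_ord0.
  have -> : [forall k, fiber f k == fiber g k].
    by apply/forallP => k; rewrite !f0.
  rewrite mul1r [RHS]big1 => [|k _]; last by rewrite f0.
  rewrite /permanent (eq_bigr (fun=> 1)) => [|s _]; last by rewrite big_ord0.
  by rewrite sumr_const card_Sn.
rewrite (permanent_expand_row _ ord0); set c := g ord0.
pose D : S := [forall k, fiber f k == fiber g k]%:R *
  \prod_(k | k != c) ((fiber f k)`!)%:R * ((fiber f c).-1)`!%:R.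
have term j : (\matrix_(i, j) ((f j == g i)%:R : S)) ord0 j *
    permanent (row' ord0 (col' j (\matrix_(i, j) ((f j == g i)%:R : S)))) =
    (f j == c)%:R * D.
  rewrite mxE -/c; case: eqP => [fj|_]; last by rewrite !mul0r.
  rewrite !mul1r; set m := row' _ _.
  have -> : m = \matrix_(i, k) (((f \o lift j) k == (g \o lift ord0) i)%:R : S).
    by apply/matrixP => a b; rewrite !mxE.
  rewrite IH /D -mulrA; congr (_%:R * _).
    congr nat_of_bool; apply: eq_forallb => k.
    by rewrite (fiber_lift f j) (fiber_lift g ord0) fj -/c eqn_add2l.
  rewrite (bigD1 c) //= mulrC; congr (_ * _).
    by apply: eq_bigr => k kc; rewrite (fiber_lift f j) fj eq_sym (negPf kc).
  by rewrite (fiber_lift f j) fj eqxx.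
rewrite (eq_bigr _ (fun j _ => term j)) -mulr_suml -natr_sum -/(fiber f c) /D.
case: forallP => [fg|_]; last by rewrite !mul0r mulr0.
rewrite !mul1r [in RHS](bigD1 c) //= mulrCA mulrC; congr (_ * _).
rewrite -natrM; congr (_%:R).
have : (0 < fiber f c)%N.
  by rewrite (eqP (fg c)) (fiber_lift g ord0) -/c eqxx.
by case: (fiber f c) => // m _; rewrite factS.
Qed.

Lemma prod_fiber (S : comNzRingType) M (f : 'I_M -> T) (x : T -> S) :
  \prod_i x (f i) = \prod_k x k ^+ fiber f k.
Proof.
rewrite (partition_big f xpredT) //=; apply: eq_bigr => k _.
rewrite (eq_bigr (fun=> x k)) => [|i /eqP -> //].
by rewrite prodr_const /fiber -big_mkcond /= sum1_card.
Qed.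

Lemma fiber_le M (f : 'I_M -> T) k : (fiber f k <= M)%N.
Proof.
rewrite /fiber -[X in (_ <= X)%N]card_ord -sum1_card.
by apply: leq_sum => i _; case: (f i == k).
Qed.

Lemma sum_fiber M (f : 'I_M -> T) : (\sum_k fiber f k = M)%N.
Proof.
rewrite /fiber exchange_big /= (eq_bigr (fun=> 1%N)) ?sum1_card ?card_ord //.
by move=> i _; rewrite (bigD1 (f i)) //= eqxx big1 // => k /negPf; rewrite eq_sym => ->.
Qed.

End Counting.

(** * Averages over phases *)
Section Torus.
Variable C : numClosedFieldType.

Lemma ex_primitive_root n : (n > 0)%N -> exists z : C, n.-primitive_root z.
Proof.
move=> n_gt0; have [r] := closed_field_poly_normal ('X^n - 1 : {poly C}).
rewrite (monicP (monicXnsubC _ n_gt0)) scale1r => rE.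
have n_unit : n%:R != 0 :> C by rewrite pnatr_eq0 -lt0n.
have r_uniq : uniq r by rewrite -separable_prod_XsubC -rE separable_Xn_sub_1.
have r_size : (n <= size r)%N.
  by rewrite -ltnS -(size_prod_XsubC r id) -rE size_XnsubC.
have r_unity : all n.-unity_root r.
  by apply/allP => z zr; rewrite /root_of_unity rE root_prod_XsubC.
by have /hasP[z _ z_prim] := has_prim_root n_gt0 r_unity r_uniq r_size; exists z.
Qed.

Definition zeta N : C := xchoose (ex_primitive_root (ltn0Sn N)).

Lemma zetaP N : N.+1.-primitive_root (zeta N).
Proof. exact: xchooseP. Qed.

Lemma norm_zeta N : `|zeta N| = 1.
Proof.
apply/eqP; rewrite -(@pexpr_eq1 _ _ N.+1) ?normr_ge0 //.
by rewrite -normrX (prim_expr_order (zetaP N)) normr1.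
Qed.

(** Orthogonality of the characters of the circle survives exactly on the
(N+1)-th roots of unity for exponents at most N; this lets finite sums
replace the integration over phases. *)
Lemma sum_zeta N a b : (a <= N)%N -> (b <= N)%N ->
  \sum_(j < N.+1) (zeta N ^+ j) ^+ a * (zeta N ^+ j)^* ^+ b = (a == b)%:R *+ N.+1.
Proof.
move=> aN bN; set z := zeta N.
have zz : z * z^* = 1 by rewrite -normCK norm_zeta expr1n.
have z0 : z != 0 by rewrite -normr_eq0 norm_zeta oner_eq0.
have [->|ab] := eqVneq a b.
  rewrite (eq_bigr (fun=> 1)) ?sumr_const ?card_ord // => j _.
  by rewrite -exprMn rmorphXn -exprMn zz !expr1n.
rewrite mul0rn; set w := z ^+ a * z^* ^+ b.
have -> : \sum_(j < N.+1) (z ^+ j) ^+ a * (z ^+ j)^* ^+ b = \sum_(j < N.+1) w ^+ j.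
  apply: eq_bigr => j _.
  by rewrite rmorphXn -!exprM mulnC [(j * b)%N]mulnC !exprM -exprMn.
have wN : w ^+ N.+1 = 1.
  rewrite exprMn -!exprM mulnC [(b * _)%N]mulnC !exprM.
  by rewrite -rmorphXn (prim_expr_order (zetaP N)) rmorph1 !expr1n mulr1.
have w1 : w != 1.
  apply/eqP => w1; move/eqP: ab; apply.
  have : z ^+ a == z ^+ b.
    apply/eqP; rewrite -[LHS]mulr1 -(expr1n _ b) -zz exprMn mulrCA -/w w1.
    by rewrite mulr1.
  by rewrite (eq_prim_root_expr (zetaP N)) !modn_small ?ltnS // => /eqP.
apply/eqP; have := subrX1 w N.+1; rewrite wN subrr => /esym/eqP.
by rewrite mulf_eq0 subr_eq0 (negPf w1).
Qed.

End Torus.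

Section SphereTorus.
Variables (R : realType) (d : nat).
Local Notation C := (R[i]).
Local Notation vec := ('I_d -> C).

Definition nsq (z : C) : R := complex.Re z ^+ 2 + complex.Im z ^+ 2.

Lemma nsqE z : (nsq z)%:C%C = z * z^*.
Proof. by rewrite /nsq add_Re2_Im2 normCK. Qed.

Lemma nsq_ge0 z : 0 <= nsq z.
Proof. by rewrite addr_ge0 ?sqr_ge0. Qed.

Definition lin (v x : vec) : C := \sum_k v k * x k.

Definition dotc (v w : vec) : C := \sum_k v k * (w k)^*.

Definition gram M (v : 'I_M -> vec) : 'M[C]_M := \matrix_(i, j) dotc (v i) (v j).

Definition torus_pt N (tau : 'I_d -> R) (m : {ffun 'I_d -> 'I_N.+1}) : vec :=
  fun k => (Num.sqrt (tau k))%:C%C * zeta C N ^+ m k.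

Definition torus_mean N (tau : 'I_d -> R) (F : vec -> R) : R :=
  (N.+1 ^ d)%:R^-1 * \sum_(m : {ffun 'I_d -> 'I_N.+1}) F (torus_pt tau m).

Definition samefib M (f g : 'I_M -> 'I_d) := [forall k, fiber f k == fiber g k].

Lemma torus_monomial N tau M (f g : 'I_M -> 'I_d) : (M <= N)%N ->
  (forall k, 0 <= tau k) ->
  \sum_(m : {ffun 'I_d -> 'I_N.+1})
     \prod_i (torus_pt tau m (f i) * (torus_pt tau m (g i))^*) =
  (N.+1 ^ d)%:R * ((samefib f g)%:R * \prod_k tau k ^+ fiber f k)%:C%C.
Proof.
move=> MN tau0.
pose h k (j : 'I_N.+1) : C :=
  ((Num.sqrt (tau k))%:C%C * zeta C N ^+ j) ^+ fiber f k *
  (((Num.sqrt (tau k))%:C%C * zeta C N ^+ j)^*) ^+ fiber g k.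
transitivity (\sum_(m : {ffun 'I_d -> 'I_N.+1}) \prod_k h k (m k)).
  apply: eq_bigr => m _.
  rewrite big_split /= (prod_fiber f (torus_pt tau m)).
  by rewrite (prod_fiber g (fun k => (torus_pt tau m k)^*)) -big_split.
rewrite -(bigA_distr_bigA h) /=.
have hE k : \sum_j h k j =
    ((fiber f k == fiber g k)%:R * tau k ^+ fiber f k)%:C%C *+ N.+1.
  have cR : ((Num.sqrt (tau k))%:C%C)^* = (Num.sqrt (tau k))%:C%C :> C.
    by apply: conj_Creal; apply/complex_realP; exists (Num.sqrt (tau k)).
  have hj j : h k j = ((Num.sqrt (tau k)) ^+ (fiber f k + fiber g k))%:C%C *
      ((zeta C N ^+ j) ^+ fiber f k * (zeta C N ^+ j)^* ^+ fiber g k).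
    by rewrite /h rmorphM /= cR !exprMn exprD rmorphM !rmorphXn /=; ring.
  rewrite (eq_bigr _ (fun j _ => hj j)) -mulr_sumr sum_zeta ?(leq_trans (fiber_le _ _)) //.
  case: eqP => [<-|_]; last by rewrite !mul0rn mulr0 mul0r rmorph0 mul0rn.
  rewrite addnn -mul2n exprM sqr_sqrtr // mul1r mulrnAr mulr1 //.
rewrite (eq_bigr _ (fun k _ => hE k)) prodrMn_const card_ord.
rewrite -mulr_natl -rmorph_prod big_split /=; congr (_ * _).
congr (_%:C)%C; congr (_ * _).
rewrite /samefib; case: forallP => [fg|fg].
  by rewrite big1 // => k _; rewrite fg.
apply/eqP; rewrite prodf_seq_eq0; apply/hasP.
have /existsP[k kn] : [exists k, fiber f k != fiber g k].
  by rewrite -negb_forall; apply/negP => /forallP.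
by exists k; rewrite ?mem_index_enum //= (negPf kn).
Qed.

Definition coefp M (v : 'I_M -> vec) (f : {ffun 'I_M -> 'I_d}) : C :=
  \prod_i v i (f i).

Lemma prod_lin M (v : 'I_M -> vec) x :
  \prod_i lin (v i) x = \sum_(f : {ffun 'I_M -> 'I_d}) coefp v f * \prod_i x (f i).
Proof.
rewrite /lin (bigA_distr_bigA (fun i k => v i k * x k)) /=.
by apply: eq_bigr => f _; rewrite big_split.
Qed.

Definition cross M (v : 'I_M -> vec) (f g : {ffun 'I_M -> 'I_d}) : R :=
  complex.Re (coefp v f * (coefp v g)^*) * (samefib f g)%:R.

Lemma cReMl (r : R) (z : C) : complex.Re (r%:C%C * z) = r * complex.Re z.
Proof. by case: z => a b /=; rewrite mul0r subr0. Qed.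

Lemma cRe_sum I (r : seq I) (P : pred I) (F : I -> C) :
  complex.Re (\sum_(i <- r | P i) F i) = \sum_(i <- r | P i) complex.Re (F i).
Proof. by apply: (big_morph (@complex.Re R)) => // -[a b] [c e]. Qed.

(** Only the pairs of monomials with the same exponents survive the average
over phases. *)
Lemma torus_mean_prod N tau M (v : 'I_M -> vec) : (M <= N)%N ->
  (forall k, 0 <= tau k) ->
  @torus_mean N tau (fun x => \prod_i nsq (lin (v i) x)) =
  \sum_(f : {ffun 'I_M -> 'I_d}) \sum_(g : {ffun 'I_M -> 'I_d})
     cross v f g * \prod_k tau k ^+ fiber f k.
Proof.
move=> MN tau0; rewrite /torus_mean.
have expand x : (\prod_i nsq (lin (v i) x))%:C%C =
   \sum_(f : {ffun 'I_M -> 'I_d}) \sum_(g : {ffun 'I_M -> 'I_d})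
     coefp v f * (coefp v g)^* * \prod_i (x (f i) * (x (g i))^*).
  rewrite rmorph_prod (eq_bigr (fun i => lin (v i) x * (lin (v i) x)^*)); last first.
    by move=> i _; exact: nsqE.
  rewrite big_split /= -rmorph_prod prod_lin rmorph_sum big_distrlr /=.
  apply: eq_bigr => f _; apply: eq_bigr => g _.
  have xg : (\prod_i x (g i))^* = \prod_i (x (g i))^* by exact: rmorph_prod.
  by rewrite rmorphM /= xg big_split /=; ring.
have E : ((\sum_(m : {ffun 'I_d -> 'I_N.+1})
     \prod_i nsq (lin (v i) (torus_pt tau m))))%:C%C =
   \sum_(f : {ffun 'I_M -> 'I_d}) \sum_(g : {ffun 'I_M -> 'I_d})
   ((N.+1 ^ d)%:R * ((samefib f g)%:R * \prod_k tau k ^+ fiber f k))%:C%C *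
     (coefp v f * (coefp v g)^*).
  rewrite rmorph_sum (eq_bigr _ (fun m _ => expand _)).
  rewrite exchange_big; apply: eq_bigr => f _.
  rewrite exchange_big; apply: eq_bigr => g _.
  rewrite -mulr_sumr torus_monomial // mulrC; congr (_ * _).
  rewrite [RHS]rmorphM /=; congr (_ * _); exact/esym/(rmorph_nat (real_complex R)).
have := congr1 (@complex.Re R) E; rewrite /= => ->.
rewrite cRe_sum mulr_sumr; apply: eq_bigr => f _.
rewrite cRe_sum mulr_sumr; apply: eq_bigr => g _.
rewrite cReMl /cross -!mulrA mulKf; first by ring.
by rewrite pnatr_eq0 expn_eq0.
Qed.

(** The same expansion for a Gram matrix: each product of inner products is
expanded in coordinates, and a pair of colourings f, g occurs once for every
permutation with g = f \o s.  Compared with torus_mean_prod, the power of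
tau_k is replaced by the factorial of its exponent. *)
Lemma Re_permanent_gram M (v : 'I_M -> vec) :
  complex.Re (permanent (gram v)) =
  \sum_(f : {ffun 'I_M -> 'I_d}) \sum_(g : {ffun 'I_M -> 'I_d})
     cross v f g * \prod_k (fiber f k)`!%:R.
Proof.
have -> : permanent (gram v) =
    \sum_(f : {ffun 'I_M -> 'I_d}) \sum_(g : {ffun 'I_M -> 'I_d})
      coefp v f * (coefp v g)^* *
      permanent (\matrix_(i, j) ((f j == g i)%:R : C)).
  transitivity (\sum_(s : 'S_M) \sum_(f : {ffun 'I_M -> 'I_d})
      coefp v f * (coefp v [ffun i => f (s i)])^*).
    rewrite /permanent (reindex_inj (@invg_inj _)) /=; apply: eq_bigr => s _.
    transitivity (\prod_i \sum_k v i k * (v (s^-1%g i) k)^*).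
      by apply: eq_bigr => i _; rewrite mxE.
    rewrite (bigA_distr_bigA (fun i k => v i k * (v (s^-1%g i) k)^*)) /=.
    apply: eq_bigr => f _; rewrite big_split /=; congr (_ * _).
    rewrite /coefp rmorph_prod /= (reindex_inj (@perm_inj _ s)) /=.
    by apply: eq_bigr => i _; rewrite permK ffunE.
  rewrite exchange_big; apply: eq_bigr => f _.
  rewrite /permanent; under [RHS]eq_bigr do rewrite mulr_sumr.
  rewrite exchange_big; apply: eq_bigr => s _.
  rewrite (bigD1 [ffun i => f (s i)]) //=.
  have -> : \prod_i (\matrix_(i0, j) ((f j == [ffun i => f (s i)] i0)%:R : C)) i (s i) = 1.
    by apply: big1 => i _; rewrite mxE ffunE eqxx.
  rewrite mulr1 big1 ?addr0 // => g gf.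
  apply/eqP; rewrite mulf_eq0; apply/orP; right.
  rewrite prodf_seq_eq0; apply/hasP.
  have /existsP[k kn] : [exists k, f (s k) != g k].
    rewrite -negb_forall; apply/negP => /forallP fg; case/eqP: gf.
    by apply/ffunP => k; rewrite ffunE; apply/esym/eqP.
  by exists k; rewrite ?mem_index_enum //= mxE (negPf kn).
rewrite cRe_sum; apply: eq_bigr => f _; rewrite cRe_sum; apply: eq_bigr => g _.
rewrite permanent_match -/(samefib f g) /cross.
have -> : (samefib f g)%:R * \prod_k ((fiber f k)`!%:R : C) =
    ((samefib f g)%:R * \prod_k (fiber f k)`!%:R)%:C%C.
  rewrite rmorphM rmorph_prod; congr (_ * _).
    exact/esym/(rmorph_nat (real_complex R)).
  by apply: eq_bigr => k _; exact/esym/(rmorph_nat (real_complex R)).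
by rewrite mulrC cReMl; ring.
Qed.

End SphereTorus.

(** * Riemann sums of beta integrals *)
Section GridMean.
Local Open Scope classical_set_scope.
Variable R : realType.

Definition grid_mean N (f : R -> R) : R :=
  N.+1%:R^-1 * \sum_(j < N.+1) f (j%:R / N.+1%:R).

(** The integral of t^p (1 - t)^q over [0, 1]. *)
Definition beta_nat p q : R := p`!%:R * q`!%:R / (p + q).+1`!%:R.

Lemma beta_nat_rec p q : beta_nat p.+1 q + beta_nat p q.+1 = beta_nat p q.
Proof.
rewrite /beta_nat addSn addnS -mulrDl !factS.
have f0 m : (m`!)%:R != 0 :> R by rewrite pnatr_eq0 -lt0n fact_gt0.
rewrite ![(_.+1 * _)%:R]natrM -!natr1 !natrD.
have n1 : (p%:R + q%:R + 1) != 0 :> R by rewrite -natrD natr1 pnatr_eq0.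
have n2 : (p%:R + q%:R + 1 + 1) != 0 :> R by rewrite -natrD !natr1 pnatr_eq0.
by field; rewrite n1 n2 f0.
Qed.

Lemma pow_succ_sub (j p : nat) :
  p.+1%:R * (j%:R : R) ^+ p <= (j.+1%:R : R) ^+ p.+1 - j%:R ^+ p.+1
    <= p.+1%:R * (j.+1%:R : R) ^+ p.
Proof.
have jj : j%:R <= j.+1%:R :> R by rewrite ler_nat.
have d1 : j.+1%:R - j%:R = 1 :> R by rewrite -natr1 addrAC subrr add0r.
rewrite subrXX d1 mul1r.
rewrite !(mulr_natl _ p.+1).
have c (x : R) : x *+ p.+1 = \sum_(i < p.+1) x by rewrite sumr_const card_ord.
rewrite !c; apply/andP; split; apply: ler_sum => i _.
- have ip : (i <= p)%N by rewrite -ltnS ltn_ord.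
  rewrite /= -[X in _ ^+ X <= _](subnK ip) exprD ler_wpM2r ?exprn_ge0 //.
  by rewrite /= lerXn2r ?nnegrE.
- have ip : (i <= p)%N by rewrite -ltnS ltn_ord.
  rewrite /= -[X in _ <= _ ^+ X](subnK ip) exprD ler_wpM2l ?exprn_ge0 //.
  by rewrite lerXn2r ?nnegrE.
Qed.

Lemma sum_pow_bounds (n p : nat) :
  let A : R := \sum_(j < n) j%:R ^+ p in
  (p.+1%:R * A <= n%:R ^+ p.+1) /\ (n%:R ^+ p.+1 <= p.+1%:R * (A + n%:R ^+ p)).
Proof.
elim: n => [|n [IH1 IH2]].
  rewrite /= big_ord0 mulr0 expr0n add0r; split => //.
  by rewrite mulr_ge0 // exprn_ge0.
rewrite /= big_ord_recr /=.
by have /andP[] := pow_succ_sub n p; rewrite !mulrDr in IH2 *; split; lra.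
Qed.

Lemma grid_mean_pow p : (fun N => grid_mean N (fun t => t ^+ p)) @ \oo --> (p.+1%:R^-1 : R).
Proof.
have E N : grid_mean N (fun t => t ^+ p) =
    (\sum_(j < N.+1) j%:R ^+ p) / N.+1%:R ^+ p.+1.
  rewrite /grid_mean exprS invfM [X in _ = _ * X]mulrC mulrA mulrC; congr (_ * _).
  by rewrite mulr_suml; apply: eq_bigr => j _; rewrite expr_div_n.
have lo : (fun N => p.+1%:R^-1 - harmonic N : R) @ \oo --> (p.+1%:R^-1 : R).
  by rewrite -[X in _ --> X]subr0; apply: cvgB; [exact: cvg_cst | exact: cvg_harmonic].
apply: (squeeze_cvgr _ lo (cvg_cst _)); apply: nearW => N; rewrite E.
have [h1 h2] := sum_pow_bounds N.+1 p; set A := (\sum_(j < N.+1) _) in h1 h2 *.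
have n0 : 0 < N.+1%:R :> R by rewrite ltr0n.
have p0 : 0 < p.+1%:R :> R by rewrite ltr0n.
have np0 := exprn_gt0 p.+1 n0.
apply/andP; split; last first.
  by rewrite ler_pdivrMr // mulrC ler_pdivlMr // mulrC.
rewrite ler_pdivlMr // /harmonic mulrBl lerBlDr.
rewrite [X in _ + _ * X]exprS mulKf ?gt_eqF //.
by rewrite mulrC ler_pdivrMr // mulrC.
Qed.

Lemma grid_meanD N f g :
  grid_mean N (fun t => f t + g t) = grid_mean N f + grid_mean N g.
Proof. by rewrite /grid_mean big_split mulrDr. Qed.

Lemma grid_meanZ N c f : grid_mean N (fun t => c * f t) = c * grid_mean N f.
Proof. by rewrite /grid_mean -mulr_sumr mulrCA. Qed.

Lemma grid_mean_sum N (I : finType) (f : I -> R -> R) :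
  grid_mean N (fun t => \sum_i f i t) = \sum_i grid_mean N (f i).
Proof. by rewrite /grid_mean exchange_big mulr_sumr. Qed.

Lemma eq_grid_mean N f g : f =1 g -> grid_mean N f = grid_mean N g.
Proof. by move=> fg; rewrite /grid_mean; congr (_ * _); apply: eq_bigr. Qed.

Lemma grid_mean_ge0 N f : (forall t, 0 <= t <= 1 -> 0 <= f t) -> 0 <= grid_mean N f.
Proof.
move=> f0; rewrite mulr_ge0 ?invr_ge0 //; apply: sumr_ge0 => j _; apply: f0.
rewrite divr_ge0 //= ler_pdivrMr ?ltr0n // mul1r ler_nat.
exact/ltnW/ltn_ord.
Qed.

Lemma grid_mean_beta p q :
  (fun N => grid_mean N (fun t => t ^+ p * (1 - t) ^+ q)) @ \oo --> beta_nat p q.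
Proof.
elim: q p => [|q IH] p.
  have -> : beta_nat p 0 = p.+1%:R^-1.
    rewrite /beta_nat addn0 mulr1 factS natrM invfM mulrCA mulfV ?mulr1 //.
    by rewrite pnatr_eq0 -lt0n fact_gt0.
  have -> : (fun N => grid_mean N (fun t => t ^+ p * (1 - t) ^+ 0)) =
            (fun N => grid_mean N (fun t => t ^+ p)).
    by apply/funext => N; apply: eq_grid_mean => t; rewrite expr0 mulr1.
  exact: grid_mean_pow.
have -> : (fun N => grid_mean N (fun t => t ^+ p * (1 - t) ^+ q.+1)) =
  (fun N => grid_mean N (fun t => t ^+ p * (1 - t) ^+ q) -
            grid_mean N (fun t => t ^+ p.+1 * (1 - t) ^+ q)).
  apply/funext => N; rewrite -[X in _ - X]mul1r -mulNr -grid_meanZ -grid_meanD.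
  by apply: eq_grid_mean => t; rewrite !exprS; ring.
have -> : beta_nat p q.+1 = beta_nat p q - beta_nat p.+1 q.
  by rewrite -[beta_nat p q]beta_nat_rec addrAC subrr add0r.
by apply: cvgB.
Qed.

Lemma cvg_fin_sum (I : finType) (u : I -> nat -> R) (l : I -> R) :
  (forall i, u i @ \oo --> l i) ->
  (fun N => \sum_i u i N) @ \oo --> \sum_i l i.
Proof. by move=> ul; apply: cvg_big => [|i _]; [exact: add_continuous | exact: ul]. Qed.

End GridMean.

(** * The mean over the unit sphere of C^4 *)
Section SphereMean.
Local Open Scope classical_set_scope.
Variable R : realType.
Local Notation C := (R[i]).
Local Notation vec := ('I_4 -> C).

(** Stick-breaking coordinates on the simplex of dimension three; the factor
6 (1 - a)^2 (1 - b) in simplex_mean is the density of the uniform probability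
in these coordinates. *)
Definition stick (a b c : R) (k : 'I_4) : R :=
  nth 0 [:: a; (1 - a) * b; (1 - a) * (1 - b) * c; (1 - a) * (1 - b) * (1 - c)] k.

Definition simplex_mean N (G : ('I_4 -> R) -> R) : R :=
  grid_mean N (fun a => grid_mean N (fun b => grid_mean N (fun c =>
    6 * (1 - a) ^+ 2 * (1 - b) * G (stick a b c)))).

(** For x uniform on the sphere the squared moduli are uniform on the simplex
and the phases are independent and uniform.  Each discretised mean is a
positive functional, so that inequalities pass to the limit. *)
Definition sphere_mean N (F : vec -> R) : R :=
  simplex_mean N (fun tau => @torus_mean R 4 N tau F).

Lemma stick_ge0 a b c k :
  0 <= a <= 1 -> 0 <= b <= 1 -> 0 <= c <= 1 -> 0 <= stick a b c k.
Proof.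
move=> /andP[a0 a1] /andP[b0 b1] /andP[c0 c1].
have a1' : 0 <= 1 - a by rewrite subr_ge0.
have b1' : 0 <= 1 - b by rewrite subr_ge0.
have c1' : 0 <= 1 - c by rewrite subr_ge0.
by case: k => -[|[|[|[|//]]]] ?; rewrite /stick /= ?mulr_ge0.
Qed.

Lemma sum_stick a b c : \sum_k stick a b c k = 1.
Proof. by rewrite !big_ord_recl big_ord0 /stick /=; ring. Qed.

Lemma simplex_mean_le N G H :
  (forall tau, (forall k, 0 <= tau k) -> \sum_k tau k = 1 -> G tau <= H tau) ->
  simplex_mean N G <= simplex_mean N H.
Proof.
move=> GH; rewrite -subr_ge0 /simplex_mean -mulN1r -grid_meanZ -grid_meanD.
apply: grid_mean_ge0 => a a01; rewrite -grid_meanZ -grid_meanD.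
apply: grid_mean_ge0 => b b01; rewrite -grid_meanZ -grid_meanD.
apply: grid_mean_ge0 => c c01.
rewrite mulN1r -mulrBr mulr_ge0 //; last first.
  rewrite subr_ge0; apply: GH; last exact: sum_stick.
  by move=> k; apply: stick_ge0.
by case/andP: b01 => _ b1; rewrite mulr_ge0 ?subr_ge0 // mulr_ge0 ?sqr_ge0.
Qed.

Lemma eq_simplex_mean N G H :
  (forall tau, (forall k, 0 <= tau k) -> \sum_k tau k = 1 -> G tau = H tau) ->
  simplex_mean N G = simplex_mean N H.
Proof.
move=> GH; apply/eqP; rewrite eq_le; apply/andP; split;
  by apply: simplex_mean_le => tau t0 t1; rewrite GH.
Qed.

Lemma simplex_meanD N G H :
  simplex_mean N (fun t => G t + H t) = simplex_mean N G + simplex_mean N H.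
Proof.
rewrite /simplex_mean -grid_meanD; apply: eq_grid_mean => a.
rewrite -grid_meanD; apply: eq_grid_mean => b.
by rewrite -grid_meanD; apply: eq_grid_mean => c; rewrite mulrDr.
Qed.

Lemma simplex_meanZ N k G :
  simplex_mean N (fun t => k * G t) = k * simplex_mean N G.
Proof.
rewrite /simplex_mean -grid_meanZ; apply: eq_grid_mean => a.
rewrite -grid_meanZ; apply: eq_grid_mean => b.
by rewrite -grid_meanZ; apply: eq_grid_mean => c; rewrite mulrCA.
Qed.

Lemma simplex_mean_sum N (I : finType) (G : I -> ('I_4 -> R) -> R) :
  simplex_mean N (fun t => \sum_i G i t) = \sum_i simplex_mean N (G i).
Proof.
rewrite /simplex_mean -grid_mean_sum; apply: eq_grid_mean => a.
rewrite -grid_mean_sum; apply: eq_grid_mean => b.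
by rewrite -grid_mean_sum; apply: eq_grid_mean => c; rewrite mulr_sumr.
Qed.

Lemma grid_meanZr N c (f : R -> R) :
  grid_mean N (fun t => f t * c) = grid_mean N f * c.
Proof. by rewrite mulrC -grid_meanZ; apply: eq_grid_mean => t; rewrite mulrC. Qed.

Lemma grid_mean_sep N (p q r : R -> R) :
  grid_mean N (fun a => grid_mean N (fun b => grid_mean N (fun c =>
    p a * q b * r c))) = grid_mean N p * grid_mean N q * grid_mean N r.
Proof.
transitivity (grid_mean N (fun a => p a * (grid_mean N q * grid_mean N r))).
  apply: eq_grid_mean => a.
  transitivity (grid_mean N (fun b => p a * q b * grid_mean N r)).
    by apply: eq_grid_mean => b; rewrite grid_meanZ.
  by rewrite grid_meanZr grid_meanZ mulrA.
by rewrite grid_meanZr mulrA.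
Qed.

(** Dirichlet's integral, a product of three beta integrals in the
stick-breaking coordinates. *)
Lemma simplex_mean_monomial (al : 'I_4 -> nat) :
  (fun N => simplex_mean N (fun tau => \prod_k tau k ^+ al k)) @ \oo -->
  (6 * (\prod_k (al k)`!%:R) / (\sum_k al k + 3)`!%:R : R).
Proof.
rewrite !big_ord_recl !big_ord0 !mulr1 addn0.
set a0 := al ord0; set a1 := al (lift _ _); set a2 := al (lift _ _).
set a3 := al (lift _ _).
have -> : (fun N => simplex_mean N (fun tau => \prod_k tau k ^+ al k)) =
  (fun N => 6 * (grid_mean N (fun t => t ^+ a0 * (1 - t) ^+ (a1 + a2 + a3 + 2)) *
   grid_mean N (fun t => t ^+ a1 * (1 - t) ^+ (a2 + a3 + 1)) *
   grid_mean N (fun t => t ^+ a2 * (1 - t) ^+ a3))).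
  apply/funext => N; rewrite -grid_mean_sep -grid_meanZ.
  apply: eq_grid_mean => a; rewrite -grid_meanZ.
  apply: eq_grid_mean => b; rewrite -grid_meanZ.
  apply: eq_grid_mean => c.
  rewrite !big_ord_recl big_ord0 mulr1 -/a0 -/a1 -/a2 -/a3 /stick /=.
  by rewrite !exprMn !exprD; ring.
have -> : 6 * (a0`!%:R * (a1`!%:R * (a2`!%:R * a3`!%:R))) /
    (a0 + (a1 + (a2 + a3)) + 3)`!%:R =
  6 * (beta_nat R a0 (a1 + a2 + a3 + 2) * beta_nat R a1 (a2 + a3 + 1) * beta_nat R a2 a3).
  rewrite /beta_nat.
  have -> : (a0 + (a1 + a2 + a3 + 2)).+1 = (a0 + (a1 + (a2 + a3)) + 3)%N by lia.
  have -> : (a1 + (a2 + a3 + 1)).+1 = (a1 + a2 + a3 + 2)%N by lia.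
  have -> : (a2 + a3).+1 = (a2 + a3 + 1)%N by lia.
  have f0 m : (m`!)%:R != 0 :> R by rewrite pnatr_eq0 -lt0n fact_gt0.
  by field; rewrite !f0.
apply: cvgZr; apply: cvgM; last exact: grid_mean_beta.
by apply: cvgM; exact: grid_mean_beta.
Qed.

(** Wick's formula on the sphere: the factorials produced by Dirichlet's
integral are those counted by Re_permanent_gram. *)
Lemma sphere_mean_prod_cvg M (v : 'I_M -> vec) :
  (fun N => sphere_mean N (fun x => \prod_i nsq (lin (v i) x))) @ \oo -->
  (6 / (M + 3)`!%:R * complex.Re (permanent (gram v)) : R).
Proof.
have -> : 6 / (M + 3)`!%:R * complex.Re (permanent (gram v)) =
  \sum_(f : {ffun 'I_M -> 'I_4}) \sum_(g : {ffun 'I_M -> 'I_4}) cross v f g *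
    (6 * (\prod_k (fiber f k)`!%:R) / (\sum_k fiber f k + 3)`!%:R).
  rewrite Re_permanent_gram mulr_sumr; apply: eq_bigr => f _.
  rewrite mulr_sumr; apply: eq_bigr => g _.
  by rewrite sum_fiber; ring.
have E : \forall N \near \oo,
    \sum_(f : {ffun 'I_M -> 'I_4}) \sum_(g : {ffun 'I_M -> 'I_4}) cross v f g *
      simplex_mean N (fun tau => \prod_k tau k ^+ fiber f k) =
    sphere_mean N (fun x => \prod_i nsq (lin (v i) x)).
  (* The average over phases is exact as soon as N reaches the degree M. *)
  exists M => // N /= MN; rewrite /sphere_mean.
  transitivity (simplex_mean N (fun tau =>
     \sum_(f : {ffun 'I_M -> 'I_4}) \sum_(g : {ffun 'I_M -> 'I_4})
       cross v f g * \prod_k tau k ^+ fiber f k)); last first.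
    by apply: eq_simplex_mean => tau t0 _; rewrite torus_mean_prod.
  rewrite simplex_mean_sum; apply: eq_bigr => f _.
  by rewrite simplex_mean_sum; apply: eq_bigr => g _; rewrite simplex_meanZ.
apply: (cvg_trans (near_eq_cvg E)).
apply: cvg_fin_sum => f; apply: cvg_fin_sum => g.
by apply: cvgZr; exact: simplex_mean_monomial.
Qed.

End SphereMean.

(** * Cauchy-Schwarz *)
Section ComplexCS.
Variable R : realType.
Local Notation C := (R[i]).

Lemma nsqM (z w : C) : nsq (z * w) = nsq z * nsq w.
Proof. by case: z w => [a b] [c e]; rewrite /nsq /=; ring. Qed.

Lemma nsq_conj (z : C) : nsq z^* = nsq z.
Proof. by case: z => [a b]; rewrite /nsq /= sqrrN. Qed.

Lemma nsq_real (r : R) : nsq (r%:C%C) = r ^+ 2.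
Proof. by rewrite /nsq /= expr0n addr0. Qed.

Lemma nsqXn (z : C) m : nsq (z ^+ m) = nsq z ^+ m.
Proof.
elim: m => [|m IH]; first by rewrite !expr0 /nsq /= expr1n expr0n addr0.
by rewrite !exprS nsqM IH.
Qed.

(** Lagrange's identity: the difference of the two sides is half the sum of
the nsq (a i * conj (b j) - a j * conj (b i)). *)
Lemma complex_CS (I : finType) (a b : I -> C) :
  nsq (\sum_i a i * b i) <= (\sum_i nsq (a i)) * (\sum_i nsq (b i)).
Proof.
have h0 : 0 <= \sum_i \sum_j nsq (a i * (b j)^* - a j * (b i)^*).
  by apply: sumr_ge0 => i _; apply: sumr_ge0 => j _; exact: nsq_ge0.
have key i j : nsq (a i * (b j)^* - a j * (b i)^*) =
    nsq (a i) * nsq (b j) + nsq (a j) * nsq (b i) -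
    2 * complex.Re (a i * b i * (a j * b j)^*).
  case: (a i) (b i) (a j) (b j) => [a1 a2] [b1 b2] [c1 c2] [e1 e2].
  by rewrite /nsq /=; ring.
have prodE (f g : I -> R) : \sum_i \sum_j f i * g j = (\sum_i f i) * (\sum_i g i).
  by rewrite mulr_suml; apply: eq_bigr => i _; rewrite mulr_sumr.
have sqE : \sum_i \sum_j complex.Re (a i * b i * (a j * b j)^*) =
    nsq (\sum_i a i * b i).
  have -> : nsq (\sum_i a i * b i) =
     complex.Re ((\sum_i a i * b i) * (\sum_i a i * b i)^*) by rewrite -nsqE.
  rewrite rmorph_sum mulr_suml cRe_sum; apply: eq_bigr => i _.
  by rewrite mulr_sumr cRe_sum.
rewrite (eq_bigr (fun i => \sum_j (nsq (a i) * nsq (b j)) +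
  \sum_j (nsq (a j) * nsq (b i)) -
    2 * \sum_j complex.Re (a i * b i * (a j * b j)^*))) in h0; last first.
  move=> i _; rewrite mulr_sumr -big_split -sumrB; apply: eq_bigr => j _; exact: key.
rewrite sumrB big_split /= [X in _ + X - _]exchange_big /= !prodE -mulr_sumr sqE in h0.
lra.
Qed.

Lemma real_CS (I : finType) (a b : I -> R) :
  (\sum_i a i * b i) ^+ 2 <= (\sum_i a i ^+ 2) * (\sum_i b i ^+ 2).
Proof.
have := @complex_CS I (fun i => (a i)%:C%C) (fun i => (b i)%:C%C).
rewrite (eq_bigr (fun i => (a i * b i)%:C%C)) => [|i _]; last by rewrite rmorphM.
rewrite -rmorph_sum nsq_real.
by rewrite !(eq_bigr _ (fun i _ => nsq_real _)).
Qed.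

End ComplexCS.

(** * Limits of sphere means *)
Section SphereLim.
Local Open Scope classical_set_scope.
Variable R : realType.
Local Notation C := (R[i]).
Local Notation vec := ('I_4 -> C).

(** The expectation of F on the sphere.  As a relation it carries convergence
along with the value, and both propagate by linearity. *)
Definition sphere_lim (F : vec -> R) (c : R) :=
  (fun N => sphere_mean N F) @ \oo --> c.

Lemma torus_meanD N (tau : 'I_4 -> R) (F G : vec -> R) :
  @torus_mean R 4 N tau (fun x => F x + G x) = torus_mean N tau F + torus_mean N tau G.
Proof. by rewrite /torus_mean big_split mulrDr. Qed.

Lemma torus_meanZ N (tau : 'I_4 -> R) k (F : vec -> R) :
  @torus_mean R 4 N tau (fun x => k * F x) = k * torus_mean N tau F.
Proof. by rewrite /torus_mean -mulr_sumr mulrCA. Qed.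

Lemma sphere_meanD N F G :
  sphere_mean N (fun x : vec => F x + G x) = sphere_mean N F + sphere_mean N G.
Proof.
rewrite /sphere_mean -simplex_meanD.
by apply: eq_simplex_mean => tau _ _; rewrite torus_meanD.
Qed.

Lemma sphere_meanZ N k F :
  sphere_mean N (fun x : vec => k * F x) = k * sphere_mean N F.
Proof.
rewrite /sphere_mean -simplex_meanZ.
by apply: eq_simplex_mean => tau _ _; rewrite torus_meanZ.
Qed.

Lemma sum_nsq_torus_pt N (tau : 'I_4 -> R) (m : {ffun 'I_4 -> 'I_N.+1}) :
  (forall k, 0 <= tau k) -> \sum_k nsq (torus_pt tau m k) = \sum_k tau k.
Proof.
move=> t0; apply: eq_bigr => k _; rewrite /torus_pt nsqM nsq_real sqr_sqrtr //.
suff -> : nsq (zeta C N ^+ m k) = 1 by rewrite mulr1.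
have z1 : nsq (zeta C N) = 1.
  by apply: complexI; rewrite nsqE -normCK norm_zeta expr1n.
by rewrite nsqXn z1 expr1n.
Qed.

Lemma sphere_mean_le N (F G : vec -> R) :
  (forall x, \sum_k nsq (x k) = 1 -> F x <= G x) ->
  sphere_mean N F <= sphere_mean N G.
Proof.
move=> FG; apply: simplex_mean_le => tau t0 t1.
rewrite /torus_mean ler_wpM2l ?invr_ge0 //; apply: ler_sum => m _.
by apply: FG; rewrite sum_nsq_torus_pt.
Qed.

Lemma sphere_limD F G a b :
  sphere_lim F a -> sphere_lim G b -> sphere_lim (fun x => F x + G x) (a + b).
Proof.
move=> Fa Gb; rewrite /sphere_lim.
under eq_fun do rewrite sphere_meanD.
exact: cvgD.
Qed.

Lemma sphere_limZ k F a :
  sphere_lim F a -> sphere_lim (fun x => k * F x) (k * a).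
Proof.
move=> Fa; rewrite /sphere_lim.
under eq_fun do rewrite sphere_meanZ.
exact: cvgZr.
Qed.

Lemma sphere_lim_ext F G a : F =1 G -> sphere_lim F a -> sphere_lim G a.
Proof. by move=> /funext ->. Qed.

Lemma sphere_lim_le F G a b :
  sphere_lim F a -> sphere_lim G b ->
  (forall x, \sum_k nsq (x k) = 1 -> F x <= G x) -> a <= b.
Proof.
move=> Fa Gb FG; apply: (ler_cvg_to Fa Gb).
by apply: nearW => N; exact: sphere_mean_le.
Qed.

Lemma sphere_lim_prod M (v : 'I_M -> vec) :
  sphere_lim (fun x => \prod_i nsq (lin (v i) x))
    (6 / (M + 3)`!%:R * complex.Re (permanent (gram v))).
Proof. exact: sphere_mean_prod_cvg. Qed.

Lemma sphere_lim1 : sphere_lim (fun=> 1) 1.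
Proof.
have := @sphere_lim_prod 0 (fun=> fun=> 0).
rewrite /permanent (eq_bigr (fun=> 1)) => [|s _]; last by rewrite big_ord0.
rewrite sumr_const card_Sn mulr1n /= mulr1 divff ?pnatr_eq0 //.
by apply: sphere_lim_ext => x; rewrite big_ord0.
Qed.

End SphereLim.

Arguments sphere_limD {R F G a b} _ _.
Arguments sphere_limZ {R} k {F a} _.
Arguments sphere_lim_prod {R M} v.
Arguments sphere_lim1 {R}.
Arguments sphere_lim_le {R F G a b} _ _ _.
Arguments sphere_lim_ext {R F G a} _ _.

(** * Permanents of Gram matrices with a repeated vector *)
Section RepeatedGram.
Variables (R : realType) (d : nat).
Local Notation C := (R[i]).
Local Notation vec := ('I_d -> C).

(** The rows are the vectors of a and the columns those of b, both continued
by copies of w up to size M; distinct a and b are needed because a Laplace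
expansion removes a vector from one side only. *)
Definition seqgram (w : vec) (a b : seq vec) M : C :=
  permanent (\matrix_(i < M, j < M) dotc (nth w a i) (nth w b j)).

Lemma seqgram_rec w x a b M :
  seqgram w (x :: a) b M.+1 = \sum_(k < M.+1) dotc x (nth w b k) *
    permanent (\matrix_(i < M, j < M) dotc (nth w a i) (nth w b (bump k j))).
Proof.
rewrite /seqgram (permanent_expand_row _ ord0); apply: eq_bigr => k _.
rewrite mxE; congr (_ * permanent _).
by apply/matrixP => i j; rewrite !mxE.
Qed.

Lemma nth_bump_ge (w : vec) b k j : (size b <= k)%N ->
  nth w b (bump k j) = nth w b j.
Proof.
rewrite /bump => bk; case: leqP => kj; last by rewrite add0n.
by rewrite !nth_default // (leq_trans bk) // add1n leqW.
Qed.

Lemma seqgram_rec1 w x a p M :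
  seqgram w (x :: a) [:: p] M.+1 =
  dotc x p * seqgram w a [::] M + M%:R * dotc x w * seqgram w a [:: p] M.
Proof.
rewrite seqgram_rec big_ord_recl /=; congr (_ * _ + _).
rewrite (eq_bigr (fun=> dotc x w * seqgram w a [:: p] M)); last first.
  move=> k _; rewrite nth_nil; congr (_ * permanent _); apply/matrixP => i j.
  by rewrite !mxE nth_bump_ge.
by rewrite sumr_const card_ord -mulrA mulr_natl.
Qed.

Lemma seqgram_rec2 w x a p q M :
  seqgram w (x :: a) [:: p; q] M.+2 =
  dotc x p * seqgram w a [:: q] M.+1 + dotc x q * seqgram w a [:: p] M.+1 +
  M%:R * dotc x w * seqgram w a [:: p; q] M.+1.
Proof.
rewrite seqgram_rec big_ord_recl big_ord_recl /= addrA; congr (_ * _ + _ * _ + _).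
- rewrite /seqgram; congr (permanent _); apply/matrixP => i [[|j] hj]; rewrite !mxE.
    by [].
  by [].
rewrite (eq_bigr (fun=> dotc x w * seqgram w a [:: p; q] M.+1)); last first.
  move=> k _; rewrite nth_nil; congr (_ * permanent _); apply/matrixP => i j.
  by rewrite !mxE nth_bump_ge.
by rewrite sumr_const card_ord -mulrA mulr_natl.
Qed.

Lemma seqgram_nil w b M :
  seqgram w [::] b M = M`!%:R * \prod_(j < M) dotc w (nth w b j).
Proof.
rewrite -(permanent_same_rows (fun j : 'I_M => dotc w (nth w b j))).
by rewrite /seqgram; congr (permanent _); apply/matrixP => i j; rewrite !mxE nth_nil.
Qed.

Variable w : vec.
Hypothesis w1 : dotc w w = 1.

Lemma seqgram_nil0 M : seqgram w [::] [::] M = M`!%:R.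
Proof.
rewrite seqgram_nil big1 ?mulr1 // => j _; by rewrite nth_nil.
Qed.

Lemma seqgram_nil1 p M : seqgram w [::] [:: p] M.+1 = M.+1`!%:R * dotc w p.
Proof.
rewrite seqgram_nil big_ord_recl big1 ?mulr1 // => j _.
by rewrite /= nth_nil.
Qed.

Lemma seqgram_nil2 p q M :
  seqgram w [::] [:: p; q] M.+2 = M.+2`!%:R * (dotc w p * dotc w q).
Proof.
rewrite seqgram_nil !big_ord_recl big1 ?mulr1 // => j _.
by rewrite /= nth_nil.
Qed.

Lemma seqgram11 y q M : seqgram w [:: y] [:: q] M.+1 =
  M`!%:R * (dotc y q + M%:R * dotc y w * dotc w q).
Proof.
rewrite seqgram_rec1 seqgram_nil0; case: M => [|M]; first by rewrite !mul0r !addr0; ring.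
by rewrite seqgram_nil1; ring.
Qed.

Lemma seqgram12 y p q M : seqgram w [:: y] [:: p; q] M.+2 =
  M.+1`!%:R * (dotc y p * dotc w q + dotc y q * dotc w p +
               M%:R * dotc y w * (dotc w p * dotc w q)).
Proof.
rewrite seqgram_rec2 !seqgram_nil1; case: M => [|M]; first by rewrite !mul0r !addr0; ring.
by rewrite seqgram_nil2; ring.
Qed.

Lemma seqgram22 x y p q M : seqgram w [:: x; y] [:: p; q] M.+2 =
  M`!%:R * (dotc x p * (dotc y q + M%:R * dotc y w * dotc w q) +
            dotc x q * (dotc y p + M%:R * dotc y w * dotc w p) +
            M%:R * dotc x w * (dotc y p * dotc w q + dotc y q * dotc w p +
               (M%:R - 1) * dotc y w * (dotc w p * dotc w q))).
Proof.
rewrite seqgram_rec2 !seqgram11; case: M => [|M]; first by rewrite !mul0r !addr0; ring.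
have -> : M.+1%:R - 1 = M%:R :> C by rewrite -natr1 addrK.
by rewrite seqgram12; ring.
Qed.

End RepeatedGram.

(** * Moments of the intensity of a frame *)
Section FrameMoments.
Variables (R : realType) (n : nat).
Local Notation C := (R[i]).
Local Notation vec := ('I_4 -> C).
Variable u : 'I_n -> vec.
Hypothesis u1 : forall i, dotc (u i) (u i) = 1.

Definition overlap i j : R := nsq (dotc (u i) (u j)).
Definition degree i : R := \sum_j overlap i j.
(** Diagonal entry (G^3)_ii of the cube of the Gram matrix G; its terms are the
triple products known as Bargmann invariants. *)
Definition bargmann i : R :=
  \sum_j \sum_l complex.Re (dotc (u i) (u j) * dotc (u j) (u l) * dotc (u l) (u i)).

Lemma dotcC (v w : vec) : dotc w v = (dotc v w)^*.
Proof.
rewrite /dotc rmorph_sum; apply: eq_bigr => k _.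
by rewrite rmorphM /= conjCK mulrC.
Qed.

Lemma overlapE i j : (overlap i j)%:C%C = dotc (u i) (u j) * dotc (u j) (u i).
Proof. by rewrite /overlap nsqE -dotcC. Qed.

Definition beam i (x : vec) : R := nsq (lin (u i) x).

Lemma cRe_natM k (z : C) : complex.Re (k%:R * z) = k%:R * complex.Re z.
Proof.
have -> : k%:R = (k%:R)%:C%C :> C by exact/esym/(rmorph_nat (real_complex R)).
by rewrite cReMl.
Qed.

Lemma cReD (y z : C) : complex.Re (y + z) = complex.Re y + complex.Re z.
Proof. by case: y z => [a b] [c e]. Qed.

Lemma sphere_lim_beams j l i m :
  sphere_lim (fun x => beam j x * beam l x * beam i x ^+ m)
    (6 * m`!%:R / (m + 5)`!%:R *
     (1 + overlap j l + m%:R * (overlap i l + overlap i j) +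
      m%:R * (complex.Re (dotc (u i) (u j) * dotc (u j) (u l) * dotc (u l) (u i)) +
              complex.Re (dotc (u i) (u l) * dotc (u l) (u j) * dotc (u j) (u i))) +
      m%:R * (m%:R - 1) * (overlap i j * overlap i l))).
Proof.
have := @sphere_lim_prod R m.+2 (fun t => nth (u i) [:: u j; u l] t).
have -> : permanent (gram (fun t : 'I_m.+2 => nth (u i) [:: u j; u l] t)) =
  seqgram (u i) [:: u j; u l] [:: u j; u l] m.+2 by [].
rewrite seqgram22 // !u1.
have -> : (m.+2 + 3 = m + 5)%N by lia.
set q := (X in 6 / _ * X).
have -> : q = m`!%:R *
     (1 + overlap j l + m%:R * (overlap i l + overlap i j) +
      m%:R * (complex.Re (dotc (u i) (u j) * dotc (u j) (u l) * dotc (u l) (u i)) +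
              complex.Re (dotc (u i) (u l) * dotc (u l) (u j) * dotc (u j) (u i))) +
      m%:R * (m%:R - 1) * (overlap i j * overlap i l)).
  rewrite /q cRe_natM; congr (_ * _).
  set r : R := 1 + overlap j l + m%:R * (overlap i l + overlap i j) +
      m%:R * (m%:R - 1) * (overlap i j * overlap i l).
  transitivity (complex.Re (r%:C%C + m%:R *
    (dotc (u i) (u j) * dotc (u j) (u l) * dotc (u l) (u i) +
     dotc (u i) (u l) * dotc (u l) (u j) * dotc (u j) (u i)))); last first.
    by rewrite cReD cRe_natM cReD /= /r; ring.
  have mE : (m%:R)%:C%C = m%:R :> C by exact: (rmorph_nat (real_complex R)).
  have rE (o1 o2 o3 k : R) :
      (1 + o1 + k * (o2 + o3) + k * (k - 1) * (o3 * o2))%:C%C =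
      1 + o1%:C%C + k%:C%C * (o2%:C%C + o3%:C%C) +
      k%:C%C * (k%:C%C - 1) * (o3%:C%C * o2%:C%C).
    by rewrite !rmorphD !rmorphM rmorphB rmorphD rmorph1.
  by congr complex.Re; rewrite /r rE mE !overlapE; ring.
rewrite mulrA (mulrAC 6) => H; apply: sphere_lim_ext H => x.
rewrite !big_ord_recl /= mulrA; congr (_ * _).
rewrite (eq_bigr (fun=> beam i x)) ?prodr_const ?card_ord // => k _.
by rewrite nth_nil.
Qed.

Definition intensity x : R := \sum_i beam i x.

Lemma sphere_lim_sum (I : finType) (F : I -> vec -> R) (c : I -> R) :
  (forall i, sphere_lim (F i) (c i)) ->
  sphere_lim (fun x => \sum_i F i x) (\sum_i c i).
Proof.
move=> FC; rewrite /sphere_lim.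
have -> : (fun N => sphere_mean N (fun x => \sum_i F i x)) =
  (fun N => \sum_i sphere_mean N (F i)).
  apply/funext => N; rewrite /sphere_mean -simplex_mean_sum.
  apply: eq_simplex_mean => tau _ _; rewrite /torus_mean exchange_big.
  by rewrite mulr_sumr.
exact: cvg_fin_sum.
Qed.

(** With G the Gram matrix, total2 is the trace of G^2 and total3 the trace
of G^3. *)
Definition total2 : R := \sum_i degree i.
Definition total3 : R := \sum_i bargmann i.

(** Expanding s^2 over pairs of vectors leaves the permanents of Gram matrices
in which u_i is repeated m times. *)
Lemma sphere_lim_intensity2 i m :
  sphere_lim (fun x => intensity x ^+ 2 * beam i x ^+ m)
    (6 * m`!%:R / (m + 5)`!%:R *
     (n%:R ^+ 2 + total2 + m%:R * (2 * n%:R * degree i + 2 * bargmann i) +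
      m%:R * (m%:R - 1) * degree i ^+ 2)).
Proof.
have H := sphere_lim_sum (fun j => sphere_lim_sum (fun l => @sphere_lim_beams j l i m)).
have -> : 6 * m`!%:R / (m + 5)`!%:R *
     (n%:R ^+ 2 + total2 + m%:R * (2 * n%:R * degree i + 2 * bargmann i) +
      m%:R * (m%:R - 1) * degree i ^+ 2) = \sum_j \sum_l
     (6 * m`!%:R / (m + 5)`!%:R *
     (1 + overlap j l + m%:R * (overlap i l + overlap i j) +
      m%:R * (complex.Re (dotc (u i) (u j) * dotc (u j) (u l) * dotc (u l) (u i)) +
              complex.Re (dotc (u i) (u l) * dotc (u l) (u j) * dotc (u j) (u i))) +
      m%:R * (m%:R - 1) * (overlap i j * overlap i l))); last first.
  apply: sphere_lim_ext H => x; rewrite /intensity expr2 mulr_suml mulr_suml.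
  apply: eq_bigr => j _; rewrite mulr_sumr mulr_suml.
  by apply: eq_bigr => l _.
under [RHS]eq_bigr do rewrite -mulr_sumr.
rewrite -mulr_sumr; congr (_ * _).
pose b j l := complex.Re (dotc (u i) (u j) * dotc (u j) (u l) * dotc (u l) (u i)).
have Esum (a1 a2 a3 a4 : 'I_n -> 'I_n -> R) :
   \sum_j \sum_l (1 + a1 j l + m%:R * a2 j l + m%:R * a3 j l +
     m%:R * (m%:R - 1) * a4 j l) =
   n%:R ^+ 2 + \sum_j \sum_l a1 j l + m%:R * \sum_j \sum_l a2 j l +
   m%:R * \sum_j \sum_l a3 j l + m%:R * (m%:R - 1) * \sum_j \sum_l a4 j l.
  have one : \sum_(j < n) \sum_(l < n) (1 : R) = n%:R ^+ 2.
    by rewrite !sumr_const !card_ord -mulrnA natrM expr2.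
  rewrite -one !mulr_sumr -!big_split /=; apply: eq_bigr => j _.
  by rewrite !mulr_sumr -!big_split.
rewrite (Esum overlap (fun j l => overlap i l + overlap i j)
  (fun j l => b j l + b l j) (fun j l => overlap i j * overlap i l)).
have sumB : \sum_j \sum_l (b j l + b l j) = 2 * bargmann i.
  rewrite (eq_bigr (fun j => \sum_l b j l + \sum_l b l j)) => [|j _]; last first.
    by rewrite big_split.
  by rewrite big_split /= [X in _ + X]exchange_big /= -/(bargmann i); ring.
have sumO : \sum_(j < n) \sum_l (overlap i l + overlap i j) = 2 * n%:R * degree i.
  rewrite (eq_bigr (fun j => degree i + n%:R * overlap i j)) => [|j _]; last first.
    by rewrite big_split /= sumr_const card_ord mulr_natl.
  rewrite big_split /= sumr_const card_ord -mulr_sumr -/(degree i) -mulr_natl.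
  by ring.
have sumP : \sum_j \sum_l (overlap i j * overlap i l) = degree i ^+ 2.
  rewrite expr2 [X in _ = X * _]/degree mulr_suml; apply: eq_bigr => j _.
  by rewrite mulr_sumr.
by rewrite sumB sumO sumP -/total2; ring.
Qed.

End FrameMoments.

Arguments sphere_lim_sum {R I F c} _.
Arguments sphere_lim_intensity2 {R n u} u1 i m.

(** * A polynomial minorant of the logarithm *)
Section LogSeries.
Local Open Scope classical_set_scope.
Variable R : realType.

(** Truncated Taylor series of ln at 1. *)
Definition logpoly D (y : R) : R := - \sum_(j < D) (1 - y) ^+ j.+1 / j.+1%:R.

Lemma is_derive_logpoly D (y : R) :
  is_derive y 1 (logpoly D) (\sum_(j < D) (1 - y) ^+ j).
Proof.
elim: D => [|D IH].
  rewrite big_ord0.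
  have -> : logpoly 0 = fun=> 0.
    by apply/funext => t; rewrite /logpoly big_ord0 oppr0.
  exact: is_derive_cst.
rewrite big_ord_recr /=.
have -> : logpoly D.+1 = logpoly D \- (fun t => (1 - t) ^+ D.+1 / D.+1%:R).
  by apply/funext => t; rewrite /logpoly big_ord_recr /= opprD.
have D0 : D.+1%:R != 0 :> R by rewrite pnatr_eq0.
have lin1 : is_derive y 1 (fun t : R => 1 - t) (-1).
  apply: is_derive_eq.
  by rewrite add0r mul1r.
have pow1 := @is_deriveX R R (fun t : R => 1 - t) D.+1 y 1 (-1) lin1.
have scaled := is_deriveZ (D.+1%:R^-1) pow1.
have E : (fun t : R => (1 - t) ^+ D.+1 / D.+1%:R) =
    D.+1%:R^-1 \*: ((fun t : R => 1 - t) ^+ D.+1).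
  by apply/funext => t; rewrite !fctE [LHS]mulrC.
rewrite E; have D1 := is_deriveB IH scaled; apply: (is_derive_eq D1).
by rewrite /GRing.scale /= mulrN1 mulrN mulKf // opprK.
Qed.

Lemma bernoulli_inv D (y : R) : 0 <= y <= 1 -> (1 - y) ^+ D * (1 + D%:R * y) <= 1.
Proof.
move=> /andP[y0 y1]; elim: D => [|D IH]; first by rewrite expr0 mul0r addr0 mulr1.
apply: le_trans IH; rewrite exprSr -mulrA ler_wpM2l ?exprn_ge0 ?subr_ge0 //.
rewrite -natr1; have : 0 <= (D%:R + 1) * y ^+ 2 by rewrite mulr_ge0 ?addr_ge0 ?sqr_ge0.
by have := sqr_ge0 y; nra.
Qed.

Lemma sum_geom D (y : R) : y * \sum_(j < D) (1 - y) ^+ j = 1 - (1 - y) ^+ D.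
Proof.
have := subrX1 (1 - y) D; rewrite addrAC subrr add0r => h.
by rewrite -[LHS]opprK -mulNr -h opprB.
Qed.

(** The shift 1 / D compensates for the singularity at 0: the derivative of
logpoly D - ln (y + 1/D) is nonnegative on [0, 1], by Bernoulli's inequality,
and the difference is nonpositive at 1. *)
Lemma logpoly_le_ln D (y : R) : 0 <= y <= 1 -> logpoly D.+1 y <= ln (y + D.+1%:R^-1).
Proof.
move=> y01; have /andP[y0 y1] := y01; set N := D.+1.
have N0 : 0 < N%:R :> R by rewrite ltr0n.
set e : R := N%:R^-1; have e0 : 0 < e by rewrite invr_gt0.
pose F (t : R) := logpoly N t - ln (t + e).
have dF (t : R) : 0 <= t -> is_derive t 1 F (\sum_(j < N) (1 - t) ^+ j - (t + e)^-1).
  move=> t0; have te : 0 < t + e by lra.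
  have dln : is_derive t 1 (fun t : R => ln (t + e)) (t + e)^-1.
    have dl := is_derive1_ln te.
    have da : is_derive t 1 (fun t : R => t + e) 1.
      by apply: is_derive_eq; rewrite addr0.
    have dc := @is_derive1_comp R (@ln R) (fun t : R => t + e) t _ _ dl da.
    by apply: (is_derive_eq dc); rewrite mulr1.
  exact: (is_deriveB (is_derive_logpoly N t) dln).
have F1 : F 1 <= 0.
  rewrite /F /logpoly big1 => [|j _]; last by rewrite subrr expr0n mul0r.
  by rewrite oppr0 sub0r oppr_le0 ln_ge0 // lerDl ltW.
suff : F y <= F 1 by rewrite /F -subr_ge0; move: F1; rewrite /F; lra.
apply: (@ger0_derive1_ndecr R F 0 1) => //.
- by move=> t; rewrite in_itv /= => /andP[t0 _]; have [] := dF t (ltW t0).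
- move=> t; rewrite in_itv /= => /andP[t0 t1]; rewrite derive1E.
  have [_ ->] := dF t (ltW t0).
  have te : 0 < t + e by rewrite addr_gt0.
  have t01 : 0 <= t <= 1 by rewrite !ltW.
  have B := bernoulli_inv N t01.
  have B' : (1 - t) ^+ N * (t + e) <= e.
    have -> : t + e = e * (1 + N%:R * t).
      by rewrite mulrDr mulr1 mulrA mulVf ?gt_eqF // mul1r addrC.
    by rewrite mulrCA -[X in _ <= X]mulr1 ler_wpM2l // ltW.
  rewrite subr_ge0 -(ler_pM2l (mulr_gt0 t0 te)) mulfK ?gt_eqF //.
  by rewrite mulrAC sum_geom mulrBl mul1r lerBrDr lerD2l.
apply: derivable_within_continuous => t; rewrite in_itv /= => /andP[t0 _].
by have [] := dF t t0.
Qed.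

End LogSeries.

(** * Jensen's inequality with weight s^2 *)
Section Jensen.
Variable R : realType.

(** Cost of the shift by e in logpoly_le_ln; it tends to 0 with e. *)
Lemma prod_shift n (y : 'I_n -> R) (e : R) : (forall i, 0 <= y i <= 1) -> 0 <= e ->
  \prod_i (y i + e) <= \prod_i y i + ((1 + e) ^+ n - 1).
Proof.
move=> y01 e0; elim: n y y01 => [|n IH] y y01.
  by rewrite !big_ord0 expr0 subrr addr0.
rewrite !big_ord_recl; have /andP[a0 a1] := y01 ord0.
have IHy := IH (fun i => y (lift ord0 i)) (fun i => y01 _).
have P1 : \prod_(i < n) y (lift ord0 i) <= 1.
  by apply: prodr_ile1 => i _; exact: y01.
have E1 : 1 <= (1 + e) ^+ n by rewrite exprn_ege1 // lerDl.
apply: (le_trans (ler_wpM2l (addr_ge0 a0 e0) IHy)); rewrite exprS.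
set P := \prod_(i < n) _ in P1 *; set Q := _ ^+ n in E1 *.
have := mulr_ge0 e0 (_ : 0 <= 1 - P); rewrite subr_ge0 => /(_ P1).
have := mulr_ge0 (_ : 0 <= 1 - y ord0) (_ : 0 <= Q - 1).
rewrite !subr_ge0 => /(_ a1 E1); lra.
Qed.

(** Jensen's inequality before averaging, as a polynomial minorant of the
product.  Write the product as s^2 exp (sum_i ln y_i - 2 ln s); the
exponential is bounded below by its tangent at mu, and ln s above by the
tangent of ln at s0.  The best mu is the average of the exponent for the
weight s^2, and the best s0 the average of s for this weight. *)
Lemma jensen_pointwise n (y : 'I_n -> R) D (s0 mu : R) :
  (forall i, 0 <= y i <= 1) -> 0 < s0 ->
  (\sum_i y i) ^+ 2 * (expR mu * (1 + \sum_i logpoly D.+1 (y i) -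
    2 * ((\sum_i y i) / s0 - 1) - 2 * ln s0 - mu)) <=
  \prod_i (y i + D.+1%:R^-1) :> R.
Proof.
move=> y01 s0_gt0; set s := \sum_i y i.
have e0 : 0 < D.+1%:R^-1 :> R by rewrite invr_gt0.
have s_ge0 : 0 <= s by apply: sumr_ge0 => i _; case/andP: (y01 i).
have ye i : 0 < y i + D.+1%:R^-1 by case/andP: (y01 i) => yi _; rewrite ltr_wpDl.
have [s_eq0|s_neq0] := eqVneq s 0.
  by rewrite s_eq0 expr0n mul0r; apply: prodr_ge0 => i _; rewrite ltW.
have s_gt0 : 0 < s by rewrite lt_def s_neq0.
have -> : \prod_i (y i + D.+1%:R^-1) = expR (\sum_i ln (y i + D.+1%:R^-1)).
  by rewrite expR_sum; apply: eq_bigr => i _; rewrite lnK ?posrE.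
set L := \sum_i logpoly D.+1 (y i).
have LL : L <= \sum_i ln (y i + D.+1%:R^-1).
  by apply: ler_sum => i _; exact: logpoly_le_ln.
apply: le_trans (_ : expR L <= _); last by rewrite ler_expR.
have lns : ln s <= ln s0 + (s / s0 - 1).
  rewrite -lerBlDl -ln_div ?posrE //.
  have q0 : 0 < s / s0 by rewrite divr_gt0.
  have := @le_ln1Dx R (s / s0 - 1); rewrite [1 + _]addrC subrK; apply; lra.
have -> : expR L = s ^+ 2 * (expR mu * expR (L - 2 * ln s - mu)).
  rewrite -expRD; have -> : mu + (L - 2 * ln s - mu) = L - 2 * ln s by ring.
  rewrite expRB mulrC -mulrA (_ : expR (2 * ln s) = s ^+ 2).
    by rewrite mulVf ?mulr1 // expf_neq0.
  by rewrite expRM_natl lnK ?posrE.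
rewrite ler_wpM2l ?sqr_ge0 // ler_wpM2l ?expR_ge0 //.
apply: le_trans (expR_ge1Dx _); lra.
Qed.

(** The mean of s^2 y_i^m is the integral over [0, 1] of
(1 - t)^4 / 4 (X f + Y t f' + Z t^2 f'') for f = t^m, with X, Y, Z the three
coefficients in sphere_lim_intensity2; mixed_moment is the value of that
integral for f = t^p (1 - t)^k. *)
Definition mixed_moment (X Y Z : R) p k : R :=
  4^-1 * (X * beta_nat R p k.+4 +
          Y * (p%:R * beta_nat R p k.+4 - k%:R * beta_nat R p.+1 k.+3) +
          Z * (p%:R * (p%:R - 1) * beta_nat R p k.+4 -
               2 * p%:R * k%:R * beta_nat R p.+1 k.+3 +
               k%:R * (k%:R - 1) * beta_nat R p.+2 k.+2)).

(** From y^p (1 - y)^(k+1) = y^p (1 - y)^k - y^(p+1) (1 - y)^k, so that the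
moments with k = 0 determine all others. *)
Lemma mixed_moment_rec X Y Z p k :
  mixed_moment X Y Z p k.+1 = mixed_moment X Y Z p k - mixed_moment X Y Z p.+1 k.
Proof.
rewrite /mixed_moment.
have b1 := beta_nat_rec R p k.+4; have b2 := beta_nat_rec R p.+1 k.+3.
have b3 := beta_nat_rec R p.+2 k.+2.
have e3 : beta_nat R p.+2 k.+3 = beta_nat R p.+2 k.+2 - beta_nat R p.+3 k.+2.
  by rewrite -b3 addrAC subrr add0r.
have e2 : beta_nat R p.+1 k.+4 = beta_nat R p.+1 k.+3 - beta_nat R p.+2 k.+3.
  by rewrite -b2 addrAC subrr add0r.
have e1 : beta_nat R p k.+4.+1 = beta_nat R p k.+4 - beta_nat R p.+1 k.+4.
  by rewrite -b1 addrAC subrr add0r.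
by rewrite e1 e2 e3 -!natr1; ring.
Qed.

Lemma mixed_moment0 X Y Z p : mixed_moment X Y Z p 0 =
  6 * p`!%:R / (p + 5)`!%:R * (X + p%:R * Y + p%:R * (p%:R - 1) * Z).
Proof.
rewrite /mixed_moment.
have f0 : ((p + 5)`!)%:R != 0 :> R by rewrite pnatr_eq0 -lt0n fact_gt0.
have -> : beta_nat R p 4 = 4 * (6 * p`!%:R / (p + 5)`!%:R).
  have e4 : (4`!)%:R = 24%:R :> R by [].
  by rewrite /beta_nat -addnS e4; field.
by field.
Qed.

Lemma mixed_moment_0k X Y Z k : mixed_moment X Y Z 0 k =
  X / (4 * (k%:R + 5)) - k%:R * Y / (4 * ((k%:R + 4) * (k%:R + 5))) +
  k%:R * (k%:R - 1) * Z / (2 * ((k%:R + 3) * ((k%:R + 4) * (k%:R + 5)))).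
Proof.
have f0 m : (m`!)%:R != 0 :> R by rewrite pnatr_eq0 -lt0n fact_gt0.
have k3 : k%:R + 3 != 0 :> R by rewrite -natrD pnatr_eq0 addn3.
have k4 : k%:R + 4 != 0 :> R by rewrite -natrD pnatr_eq0 addn4.
have k5 : k%:R + 5 != 0 :> R by rewrite -natrD pnatr_eq0 addnS.
have F5 : (k.+4.+1)`!%:R = (k%:R + 5) * (k.+4)`!%:R :> R.
  by rewrite factS natrM; congr (_ * _); rewrite -!natr1; ring.
have F4 : (k.+4)`!%:R = (k%:R + 4) * (k.+3)`!%:R :> R.
  by rewrite factS natrM; congr (_ * _); rewrite -!natr1; ring.
have F3 : (k.+3)`!%:R = (k%:R + 3) * (k.+2)`!%:R :> R.
  by rewrite factS natrM; congr (_ * _); rewrite -!natr1; ring.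
have B0 : beta_nat R 0 k.+4 = (k%:R + 5)^-1.
  by rewrite /beta_nat add0n F5 fact0; field; rewrite f0 k5.
have B1 : beta_nat R 1 k.+3 = ((k%:R + 4) * (k%:R + 5))^-1.
  have g1 : (1`!)%:R = 1 :> R by [].
  by rewrite /beta_nat add1n F5 F4 g1; field; rewrite f0 k4 k5.
have B2 : beta_nat R 2 k.+2 = 2 / ((k%:R + 3) * ((k%:R + 4) * (k%:R + 5))).
  have g2 : (2`!)%:R = 2 :> R by [].
  by rewrite /beta_nat addSn add1n F5 F4 F3 g2; field; rewrite f0 k3 k4 k5.
by rewrite /mixed_moment B0 B1 B2; field; rewrite k3 k4 k5.
Qed.

End Jensen.

(** * Weighted means of the logarithm *)
Section LogMoment.
Variable R : realType.

(** The sums telescope after decomposition into partial fractions; the terms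
1 / (k (k + 5)) yield 137 / 60 = 1 + 1/2 + 1/3 + 1/4 + 1/5 as the coefficient
of X / 20. *)
Lemma sum_mixed_moment (X Y Z : R) D :
  \sum_(j < D) mixed_moment X Y Z 0 j.+1 / j.+1%:R =
  X / 20 * (137 / 60 - ((D%:R + 1)^-1 + (D%:R + 2)^-1 + (D%:R + 3)^-1 +
                        (D%:R + 4)^-1 + (D%:R + 5)^-1)) -
  Y / 20 * (1 - 5 / (D%:R + 5)) +
  Z * (20^-1 - (D%:R + 2) / (2 * ((D%:R + 4) * (D%:R + 5)))).
Proof.
elim: D => [|D IH]; first by rewrite big_ord0; field.
rewrite big_ord_recr /= IH mixed_moment_0k -!natr1.
have : 0 <= D%:R :> R by [].
move: (D%:R : R) => d d0; field.
by do ?[apply/andP; split]; apply: lt0r_neq0; lra.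
Qed.

Lemma sum_mixed_moment_le (X Y Z : R) D : 0 <= X -> 0 <= Z ->
  \sum_(j < D.+1) mixed_moment X Y Z 0 j.+1 / j.+1%:R <=
  (137 / 60 * X - Y + Z) / 20 + `|Y| * D.+1%:R^-1.
Proof.
move=> X0 Z0; rewrite sum_mixed_moment.
have : 0 < D.+1%:R :> R by rewrite ltr0n.
move: (D.+1%:R : R) => d d0.
have p k : 0 <= k -> 0 < (d + k)^-1 by move=> k0; rewrite invr_gt0; lra.
have q1 := p 1 ler01; have q2 := p 2 (ler0n _ 2); have q3 := p 3 (ler0n _ 3).
have q4 := p 4 (ler0n _ 4); have q5 := p 5 (ler0n _ 5).
have XX := mulr_ge0 X0 (ltW (addr_gt0 (addr_gt0 (addr_gt0 (addr_gt0 q1 q2) q3) q4) q5)).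
have ZZ : 0 <= Z * ((d + 2) / (2 * ((d + 4) * (d + 5)))).
  by rewrite mulr_ge0 // divr_ge0 ?mulr_ge0 //; lra.
have YY : Y * (d + 5)^-1 <= `|Y| * d^-1.
  apply: le_trans (_ : `|Y| * (d + 5)^-1 <= _).
    by rewrite ler_wpM2r ?ler_norm // ltW.
  by rewrite ler_wpM2l // lef_pV2 ?posrE //; lra.
have Yn := normr_ge0 Y.
have Yd : 0 <= `|Y| * d^-1 by rewrite mulr_ge0 // invr_ge0 ltW.
lra.
Qed.

End LogMoment.

(** * Lower bound for the permanent of a Gram matrix *)
Section LowerBound.
Local Open Scope classical_set_scope.
Variables (R : realType) (n : nat).
Local Notation C := (R[i]).
Local Notation vec := ('I_4 -> C).
Variable u : 'I_n -> vec.
Hypothesis u1 : forall i, dotc (u i) (u i) = 1.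
Hypothesis n_gt0 : (0 < n)%N.

Let X : R := n%:R ^+ 2 + total2 u.
Let Y i : R := 2 * n%:R * degree u i + 2 * bargmann u i.
Let Z i : R := degree u i ^+ 2.

Lemma sphere_lim_mixed i p k :
  sphere_lim (fun x => intensity u x ^+ 2 * beam u i x ^+ p * (1 - beam u i x) ^+ k)
    (mixed_moment X (Y i) (Z i) p k).
Proof.
elim: k p => [|k IH] p.
  rewrite mixed_moment0; have H := sphere_lim_intensity2 u1 i p.
  by apply: sphere_lim_ext H => x; rewrite expr0 mulr1.
rewrite mixed_moment_rec -[X in _ - X]mul1r -mulNr.
have H := sphere_limD (IH p) (sphere_limZ (-1) (IH p.+1)).
apply: sphere_lim_ext H => x.
by rewrite !exprS; ring.
Qed.

Lemma degree_ge0 i : 0 <= degree u i.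
Proof. by apply: sumr_ge0 => j _; exact: nsq_ge0. Qed.

Lemma total2_ge0 : 0 <= total2 u.
Proof. by apply: sumr_ge0 => j _; exact: degree_ge0. Qed.

Lemma sphere_lim_sq : sphere_lim (fun x => intensity u x ^+ 2) (X / 20).
Proof.
have H := sphere_lim_intensity2 u1 (Ordinal n_gt0) 0.
have -> : X / 20 = 6 * 0`!%:R / (0 + 5)`!%:R *
  (X + 0%:R * Y (Ordinal n_gt0) + 0%:R * (0%:R - 1) * Z (Ordinal n_gt0)).
  have -> : (0`!)%:R = 1 :> R by [].
  have -> : ((0 + 5)`!)%:R = 120%:R :> R by [].
  by field.
by apply: sphere_lim_ext H => x; rewrite expr0 mulr1.
Qed.

Lemma sphere_lim_cube : sphere_lim (fun x => intensity u x ^+ 3)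
  ((n%:R ^+ 3 + 3 * n%:R * total2 u + 2 * total3 u) / 120).
Proof.
have H := sphere_lim_sum (fun i => sphere_lim_intensity2 u1 i 1).
have -> : (n%:R ^+ 3 + 3 * n%:R * total2 u + 2 * total3 u) / 120 =
  \sum_(i < n) 6 * 1`!%:R / (1 + 5)`!%:R * (X + 1%:R * Y i + 1%:R * (1%:R - 1) * Z i).
  have -> : (1`!)%:R = 1 :> R by [].
  have -> : ((1 + 5)`!)%:R = 720%:R :> R by [].
  transitivity (\sum_(i < n) (X / 120 + n%:R / 60 * degree u i + 60^-1 * bargmann u i)).
    rewrite !big_split /= sumr_const card_ord -!mulr_sumr -mulr_natl.
    by rewrite -/(total2 u) -/(total3 u) /X; field.
  by apply: eq_bigr => i _; rewrite /Y; field.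
apply: sphere_lim_ext H => x.
rewrite (exprSr _ 2) [X in _ = _ * X]/intensity mulr_sumr.
by apply: eq_bigr => i _; rewrite expr1.
Qed.

Lemma beam_le1 i x : \sum_k nsq (x k) = 1 -> 0 <= beam u i x <= 1.
Proof.
move=> x1; rewrite nsq_ge0 /=; apply: le_trans (complex_CS _ _) _.
rewrite x1 mulr1; suff -> : \sum_k nsq (u i k) = 1 by [].
apply: complexI; rewrite rmorph_sum /= -[RHS](u1 i).
by apply: eq_bigr => k _; rewrite nsqE.
Qed.

(** Average, for the weight s^2, of the exponent
sum_i ln y_i - 2 (ln s0 + s / s0 - 1) of jensen_pointwise. *)
Definition log_gain (s0 : R) : R :=
  2 - 2 * ln s0 - (\sum_i (137 / 60 * X - Y i + Z i) / 20 +
    2 / s0 * ((n%:R ^+ 3 + 3 * n%:R * total2 u + 2 * total3 u) / 120)) / (X / 20).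

Lemma X_gt0 : 0 < X.
Proof. by rewrite ltr_wpDr ?total2_ge0 // exprn_gt0 // ltr0n. Qed.

(** Average of jensen_pointwise over the sphere, with mu = log_gain s0 so that
the constant left over by the tangent is the mean X / 20 of s^2. *)
Lemma permanent_lower_approx s0 D : 0 < s0 ->
  expR (log_gain s0) * (X / 20 - \sum_i (`|Y i| * D.+1%:R^-1)) <=
  6 / (n + 3)`!%:R * complex.Re (permanent (gram u)) + ((1 + D.+1%:R^-1) ^+ n - 1).
Proof.
move=> s0_gt0; set mu := log_gain s0; set err := _ ^+ n - 1.
pose m3 := (n%:R ^+ 3 + 3 * n%:R * total2 u + 2 * total3 u) / 120 : R.
have X0 : X / 20 != 0 by rewrite gt_eqF // divr_gt0 // X_gt0.
have Lsum : sphere_lim (fun x => intensity u x ^+ 2 *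
    \sum_i logpoly D.+1 (beam u i x))
   (\sum_i - \sum_(j < D.+1) mixed_moment X (Y i) (Z i) 0 j.+1 / j.+1%:R).
  have H i : sphere_lim (fun x => -1 * \sum_(j < D.+1) (j.+1%:R^-1 * (intensity u x ^+ 2 *
      beam u i x ^+ 0 * (1 - beam u i x) ^+ j.+1)))
      (-1 * \sum_(j < D.+1) (j.+1%:R^-1 * mixed_moment X (Y i) (Z i) 0 j.+1)).
    apply: sphere_limZ; apply: sphere_lim_sum => j; apply: sphere_limZ.
    exact: sphere_lim_mixed.
  have -> : \sum_i - \sum_(j < D.+1) mixed_moment X (Y i) (Z i) 0 j.+1 / j.+1%:R =
    \sum_i -1 * \sum_(j < D.+1) (j.+1%:R^-1 * mixed_moment X (Y i) (Z i) 0 j.+1).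
    apply: eq_bigr => i _; rewrite mulN1r; congr (- _).
    by apply: eq_bigr => j _; rewrite mulrC.
  apply: sphere_lim_ext (sphere_lim_sum H) => x.
  rewrite mulr_sumr; apply: eq_bigr => i _.
  rewrite /logpoly mulN1r mulrN mulr_sumr; congr (- _).
  by apply: eq_bigr => j _; rewrite expr0 mulr1; ring.
have L := sphere_limZ (expR mu) (sphere_limD (sphere_limD
  (sphere_limZ (3 - 2 * ln s0 - mu) sphere_lim_sq) Lsum)
  (sphere_limZ (- (2 / s0)) sphere_lim_cube)).
have U := sphere_limD (sphere_lim_prod u) (sphere_limZ err sphere_lim1).
have := sphere_lim_le L U; rewrite mulr1 => LU.
apply: le_trans (LU _) => {LU}; last first.
  move=> x x1.
  have y01 i : 0 <= beam u i x <= 1 by exact: beam_le1.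
  have e0 : 0 <= D.+1%:R^-1 :> R by rewrite invr_ge0.
  apply: le_trans (prod_shift y01 e0).
  apply: le_trans (jensen_pointwise D mu y01 s0_gt0).
  rewrite -/(intensity u x) le_eqVlt; apply/orP; left; apply/eqP.
  by field; rewrite gt_eqF.
rewrite ler_wpM2l ?expR_ge0 //.
have S : \sum_i \sum_(j < D.+1) mixed_moment X (Y i) (Z i) 0 j.+1 / j.+1%:R <=
   \sum_i ((137 / 60 * X - Y i + Z i) / 20 + `|Y i| * D.+1%:R^-1).
  apply: ler_sum => i _; apply: sum_mixed_moment_le; first exact/ltW/X_gt0.
  exact: sqr_ge0.
rewrite big_split /= in S; rewrite sumrN.
have muE : (3 - 2 * ln s0 - mu) * (X / 20) =
   X / 20 + (\sum_i (137 / 60 * X - Y i + Z i) / 20 + 2 / s0 * m3).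
  rewrite /mu /log_gain -/m3; field.
  by apply/andP; split; apply: lt0r_neq0; rewrite ?X_gt0.
rewrite muE -/m3; lra.
Qed.

Theorem permanent_lower s0 : 0 < s0 ->
  expR (log_gain s0) * (X / 20) <=
  6 / (n + 3)`!%:R * complex.Re (permanent (gram u)).
Proof.
move=> s0_gt0.
have H1 : (fun D => expR (log_gain s0) * (X / 20 - \sum_i (`|Y i| * harmonic D))) @ \oo
    --> expR (log_gain s0) * (X / 20).
  have S0 : (fun D => \sum_i (`|Y i| * harmonic D)) @ \oo --> (0 : R).
    have := @cvg_fin_sum R 'I_n (fun i D => `|Y i| * harmonic D) (fun i => `|Y i| * 0).
    rewrite [X in _ --> X]big1 => [|i _]; last by rewrite mulr0.
    by apply=> i; apply: cvgZr; exact: cvg_harmonic.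
  by apply: cvgZr; rewrite -[X in _ --> X]subr0; apply: cvgB; [exact: cvg_cst | ].
have H2 : (fun D => 6 / (n + 3)`!%:R * complex.Re (permanent (gram u)) +
     ((1 + harmonic D) ^+ n - 1)) @ \oo -->
    6 / (n + 3)`!%:R * complex.Re (permanent (gram u)).
  have S1 m : (fun D => (1 + harmonic D) ^+ m) @ \oo --> (1 : R).
    elim: m => [|m IH]; first by under eq_fun do rewrite expr0; exact: cvg_cst.
    rewrite -[X in _ --> X]mulr1; under eq_fun do rewrite exprS.
    apply: cvgM => //; rewrite -[X in _ --> X]addr0.
    by apply: cvgD; [exact: cvg_cst | exact: cvg_harmonic].
  rewrite -[X in _ --> X]addr0; apply: cvgD; first exact: cvg_cst.
  have S2 := cvgB (S1 n) (cvg_cst (1 : R)).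
  by rewrite subrr in S2; exact: S2.
apply: (ler_cvg_to H1 H2); apply: nearW => D.
exact: permanent_lower_approx.
Qed.

End LowerBound.

(** * Eliminating the third moment *)
Section FrameBounds.
Variables (R : realType) (n : nat).
Local Notation C := (R[i]).
Local Notation vec := ('I_4 -> C).
Variable u : 'I_n -> vec.
Hypothesis u1 : forall i, dotc (u i) (u i) = 1.

Lemma sum_nsq_unit i : \sum_k nsq (u i k) = 1.
Proof.
apply: complexI; rewrite rmorph_sum /= -[RHS](u1 i).
by apply: eq_bigr => k _; rewrite nsqE.
Qed.

Lemma overlap_le1 i j : overlap u i j <= 1.
Proof.
apply: le_trans (complex_CS _ _) _; rewrite sum_nsq_unit mul1r.
rewrite (eq_bigr (fun k => nsq (u j k))) ?sum_nsq_unit // => k _.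
by rewrite nsq_conj.
Qed.

(** With S the frame operator, degree i is <u_i, S u_i> and bargmann i is
|S u_i|^2. *)
Lemma sqr_degree_le i : degree u i ^+ 2 <= bargmann u i.
Proof.
pose w k := \sum_j dotc (u i) (u j) * u j k.
have dE : (degree u i)%:C%C = \sum_k w k * (u i k)^*.
  rewrite /degree rmorph_sum; transitivity (\sum_j dotc (u i) (u j) * dotc (u j) (u i)).
    by apply: eq_bigr => j _; exact: overlapE.
  rewrite /w; under [RHS]eq_bigr do rewrite mulr_suml.
  rewrite exchange_big; apply: eq_bigr => j _.
  by rewrite /dotc mulr_sumr; apply: eq_bigr => k _; rewrite mulrA.
have bE : (\sum_k nsq (w k)) = bargmann u i.
  have -> : \sum_k nsq (w k) = complex.Re (\sum_k w k * (w k)^*).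
    by rewrite cRe_sum; apply: eq_bigr => k _; rewrite -nsqE.
  rewrite /bargmann; under [RHS]eq_bigr do rewrite -cRe_sum.
  rewrite -cRe_sum; congr complex.Re.
  transitivity (\sum_k \sum_j \sum_l
     dotc (u i) (u j) * u j k * ((dotc (u i) (u l))^* * (u l k)^*)).
    apply: eq_bigr => k _; rewrite /w rmorph_sum big_distrlr /=.
    by apply: eq_bigr => j _; apply: eq_bigr => l _; rewrite rmorphM.
  rewrite exchange_big; apply: eq_bigr => j _.
  rewrite exchange_big; apply: eq_bigr => l _.
  rewrite -(dotcC (u i) (u l)) [X in _ = _ * X * _]/dotc.
  by rewrite mulr_sumr mulr_suml; apply: eq_bigr => k _; ring.
have := complex_CS w (fun k => (u i k)^*).
rewrite -dE nsq_real bE (eq_bigr (fun k => nsq (u i k))) => [|k _]; last first.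
  by rewrite nsq_conj.
by rewrite sum_nsq_unit mulr1.
Qed.

Lemma total2_le_total3 : total2 u ^+ 2 <= n%:R * total3 u.
Proof.
have := real_CS (fun _ : 'I_n => 1) (degree u).
rewrite (eq_bigr (degree u)) => [|i _]; last by rewrite mul1r.
rewrite -/(total2 u) expr1n sumr_const card_ord => /le_trans; apply.
by rewrite ler_wpM2l //; apply: ler_sum => i _; exact: sqr_degree_le.
Qed.

(** The trace of the frame operator S on C^4 is n and its squared
Hilbert-Schmidt norm is total2; the four diagonal entries of S suffice for
Cauchy-Schwarz. *)
Lemma total2_ge : n%:R ^+ 2 <= 4 * total2 u.
Proof.
pose S k l := \sum_i u i k * (u i l)^*.
have p2E : total2 u = \sum_k \sum_l nsq (S k l).
  apply: complexI; rewrite /total2 /degree rmorph_sum.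
  transitivity (\sum_i \sum_j \sum_k \sum_l
    (u i k * (u i l)^*) * (u j k * (u j l)^*)^*).
    apply: eq_bigr => i _; rewrite rmorph_sum; apply: eq_bigr => j _.
    rewrite [LHS]nsqE /dotc rmorph_sum big_distrlr /=.
    apply: eq_bigr => k _; apply: eq_bigr => l _.
    by rewrite !rmorphM /= !conjCK; ring.
  rewrite exchange_big /=.
  transitivity (\sum_k \sum_l \sum_j \sum_i
    (u i k * (u i l)^*) * (u j k * (u j l)^*)^*).
    under eq_bigr do rewrite exchange_big /=.
    rewrite exchange_big /=; apply: eq_bigr => k _.
    rewrite exchange_big /= exchange_big /=.
    under eq_bigr do rewrite exchange_big /=.
    rewrite exchange_big /=.
    by apply: eq_bigr => l _; apply: eq_bigr => j _.
  rewrite rmorph_sum; apply: eq_bigr => k _.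
  rewrite rmorph_sum; apply: eq_bigr => l _.
  rewrite [RHS]nsqE /S rmorph_sum big_distrlr /= exchange_big /=.
  by apply: eq_bigr => i _.
have trS : \sum_k complex.Re (S k k) = n%:R.
  rewrite /S -cRe_sum exchange_big /= cRe_sum.
  rewrite (eq_bigr (fun=> 1)) ?sumr_const ?card_ord // => i _.
  by have := congr1 (@complex.Re R) (u1 i); rewrite /dotc => ->.
have := real_CS (fun _ : 'I_4 => 1) (fun k => complex.Re (S k k)).
rewrite (eq_bigr (fun k => complex.Re (S k k))) => [|i _]; last by rewrite mul1r.
rewrite trS expr1n sumr_const card_ord => /le_trans; apply.
rewrite ler_wpM2l // p2E; apply: ler_sum => k _.
rewrite (bigD1 k) //= ler_wpDr ?sumr_ge0 //.
  by move=> l _; exact: nsq_ge0.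
by rewrite /nsq lerDl sqr_ge0.
Qed.

Lemma total2_le : total2 u <= n%:R ^+ 2.
Proof.
have -> : n%:R ^+ 2 = \sum_(i < n) \sum_(j < n) (1 : R).
  by rewrite !sumr_const !card_ord -mulrnA natrM expr2.
by apply: ler_sum => i _; apply: ler_sum => j _; exact: overlap_le1.
Qed.

(** The bound obtained when every degree i is q and every bargmann i is q^2. *)
Definition permanent_bound (q : R) : R :=
  (n + 3)`!%:R * (3 / 10) * (n%:R * (n%:R + q)) / (n%:R + 2 * q) ^+ 2 *
  expR (- (137 / 60) * n%:R + (2 * n%:R * q + q ^+ 2) / (n%:R + q)).

(** Among the frames with given q the estimate permanent_lower is weakest when
total3 takes its least possible value n q^2: once sqr_degree_le has replaced
the squared degrees, total3 appears with the coefficient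
1/20 - 1/(30 s0), which is nonnegative for n >= 3. *)
Theorem permanent_gram_ge : (3 <= n)%N ->
  permanent_bound (total2 u / n%:R) <= complex.Re (permanent (gram u)).
Proof.
move=> n3; have n_gt0 : (0 < n)%N by lia.
set N : R := n%:R; have N3 : 3 <= N by rewrite ler_nat.
have N0 : 0 < N by lra.
set q := total2 u / N.
have p2E : total2 u = N * q by rewrite /q mulrCA mulfV ?mulr1 // gt_eqF.
have q_ge : N / 4 <= q.
  have := total2_ge; rewrite p2E expr2 -/N => h.
  have : N * (N / 4) <= N * q by lra.
  by rewrite ler_pM2l.
have q0 : 0 < q by lra.
(* The weighted mean of s when total3 = N q^2. *)
pose s0 : R := (N + 2 * q) / 6.
have s0_gt0 : 0 < s0 by rewrite /s0; lra.
have p3_ge : N * q ^+ 2 <= total3 u.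
  have := total2_le_total3; rewrite p2E -/N => h.
  by rewrite -(ler_pM2l N0); apply: le_trans h; rewrite le_eqVlt; apply/orP; left; apply/eqP; ring.
have H := permanent_lower u1 n_gt0 s0_gt0.
have f0 : 0 < ((n + 3)`!)%:R :> R by rewrite ltr0n fact_gt0.
have X0 : 0 < N ^+ 2 + N * q by nra.
have sumE : \sum_i (137 / 60 * (N ^+ 2 + N * q) -
   (2 * N * degree u i + 2 * bargmann u i) + degree u i ^+ 2) / 20 <=
   (N * (137 / 60) * (N ^+ 2 + N * q) - 2 * N * (N * q) - total3 u) / 20.
  rewrite -mulr_suml ler_wpM2r ?invr_ge0 //.
  apply: le_trans (_ : \sum_i (137 / 60 * (N ^+ 2 + N * q) -
      2 * N * degree u i - bargmann u i) <= _).
    by apply: ler_sum => i _; have := sqr_degree_le i; lra.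
  rewrite !sumrB sumr_const card_ord -mulr_sumr -/(total2 u) -/(total3 u) p2E.
  by rewrite -mulr_natl -/N; lra.
set e := - (137 / 60) * N + (2 * N * q + q ^+ 2) / (N + q).
have gain_ge : - (2 * ln s0) + e <= log_gain u s0.
  rewrite /log_gain p2E -/N.
  set A := \sum_i _ in sumE *; set p3 := total3 u in sumE p3_ge *.
  suff : (A + 2 / s0 * ((N ^+ 3 + 3 * N * (N * q) + 2 * p3) / 120)) /
         ((N ^+ 2 + N * q) / 20) <= 2 - e by lra.
  rewrite ler_pdivrMr ?divr_gt0 //.
  have -> : 2 / s0 * ((N ^+ 3 + 3 * N * (N * q) + 2 * p3) / 120) =
     N * (N + q) / 10 + (p3 - N * q ^+ 2) / (30 * s0).
    by rewrite /s0; field; apply: lt0r_neq0; lra.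
  have -> : (2 - e) * ((N ^+ 2 + N * q) / 20) =
     (N * (137 / 60) * (N ^+ 2 + N * q) - 2 * N * (N * q) - N * q ^+ 2) / 20 +
     N * (N + q) / 10.
    by rewrite /e; field; apply: lt0r_neq0; lra.
  have : (p3 - N * q ^+ 2) / (30 * s0) <= (p3 - N * q ^+ 2) / 20.
    by rewrite ler_wpM2l ?subr_ge0 // lef_pV2 ?posrE /s0; lra.
  lra.
have -> : permanent_bound q = ((n + 3)`!)%:R / 6 *
   (expR (- (2 * ln s0) + e) * ((N ^+ 2 + N * q) / 20)).
  rewrite (expRD (- (2 * ln s0))) expRN expRM_natl lnK ?posrE //.
  rewrite /permanent_bound -/N -/e.
  by rewrite /s0; field; apply: lt0r_neq0; lra.
apply: le_trans (_ : ((n + 3)`!)%:R / 6 *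
   (expR (log_gain u s0) * ((N ^+ 2 + N * q) / 20)) <= _).
  rewrite ler_wpM2l ?divr_ge0 // ler_wpM2r ?ler_expR //.
  by rewrite divr_ge0 // ltW.
rewrite p2E -/N in H; apply: (le_trans (ler_wpM2l (divr_ge0 (ltW f0) (ler0n R 6)) H)).
rewrite le_eqVlt; apply/orP; left; apply/eqP.
by field; rewrite gt_eqF.
Qed.

End FrameBounds.

(** * Numerical comparison of the two bounds *)
Section Numeric.
Variable R : realType.

Lemma expR1_le : expR 1 <= 2719 / 1000 :> R.
Proof.
pose S n : R := series (exp_coeff 1) n.
have S_rec n : S n.+1 = S n + (n`!%:R)^-1.
  by rewrite /S /series /= big_nat_recr //= exp_coeffE /= expr1n mulr1.
(* S n + 2 / n! decreases for n >= 1 and dominates S n. *)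
have tail n : S (n + 7)%N + 2 / ((n + 7)`!)%:R <= S 7 + 2 / (7`!)%:R.
  elim: n => [|n IH]; first by [].
  apply: le_trans IH; rewrite addSn S_rec -addrA lerD2l.
  rewrite factS natrM invfM mulrA.
  set f := ((_)`!)%:R^-1; have f0 : 0 <= f by rewrite invr_ge0.
  suff : 2 / (n + 7).+1%:R <= 1 :> R.
    by move=> h; have := ler_wpM2r f0 h; move: (_ / _ * f) => t; lra.
  by rewrite ler_pdivrMr ?ltr0n // mul1r ler_nat; lia.
have S7 : S 7 + 2 / (7`!)%:R <= 2719 / 1000.
  rewrite !S_rec; have -> : S 0 = 0 by rewrite /S /series /= big_geq.
  have -> : (7`!)%:R = 5040 :> R by rewrite (factS 6) natrM; congr (_ * _).
  have -> : (6`!)%:R = 720 :> R by [].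
  have -> : (5`!)%:R = 120 :> R by [].
  have -> : (4`!)%:R = 24 :> R by [].
  have -> : (3`!)%:R = 6 :> R by [].
  have -> : (2`!)%:R = 2 :> R by [].
  rewrite !(fact0, (erefl : 1`! = 1%N)); lra.
rewrite /expR; apply: limr_le; first exact: is_cvg_series_exp_coeff.
exists 7%N => // n /= n7; apply: le_trans S7.
have := tail (n - 7)%N; rewrite subnK // => h; apply: le_trans h.
rewrite -/(S n) -[X in X <= _]addr0 lerD2l.
by rewrite divr_ge0.
Qed.

Lemma exp_third_le : expR (3^-1) <= 6979 / 5000 :> R.
Proof.
have h : expR (3^-1) ^+ 3 <= (6979 / 5000) ^+ 3 :> R.
  rewrite -expRM_natl mulfV ?pnatr_eq0 //; apply: le_trans expR1_le _; lra.
by rewrite ler_pXn2r ?nnegrE ?expR_ge0 // in h; lra.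
Qed.

(** The comparison of the two bounds for ten vectors forming a tight frame
(n = 10, q = 5 / 2), cleared of denominators.  The power e^(110/3) is bounded
through e^(1/3), and each power is rounded to a short decimal so that the
final comparison of rationals stays small. *)
Lemma base_constant :
  minc (5 / 2) ^+ 10 * 36 * expR (110 / 3) <=
  rho4 R * (13 * 12 * 11 * 10 * 9 * 8 * 7 * 720) ^+ 2 :> R.
Proof.
have w10 : expR (3^-1) ^+ 10 <= 2807 / 100 :> R.
  apply: le_trans (_ : (6979 / 5000) ^+ 10 <= _); last lra.
  by rewrite lerXn2r ?nnegrE ?expR_ge0 ?exp_third_le //; lra.
have -> : expR (110 / 3) = (expR (3^-1) ^+ 10) ^+ 11 :> R.
  by rewrite -exprM -expRM_natl.
have w110 : (expR (3^-1) ^+ 10) ^+ 11 <= (2807 / 100) ^+ 11 :> R.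
  by rewrite lerXn2r ?nnegrE ?exprn_ge0 ?expR_ge0 //; lra.
apply: le_trans (ler_wpM2l _ w110) _; first by rewrite /minc; lra.
rewrite /minc /rho4; lra.
Qed.

(** With k = q / n, permanent_bound n q is (n+3)! * shape k * exp (n * rate k). *)
Definition rate (k : R) : R := - (137 / 60) + (2 * k + k ^+ 2) / (1 + k).

Definition shape (k : R) : R := 3 / 10 * ((1 + k) / (1 + 2 * k) ^+ 2).

(** The inequality needed to pass from n to n + 1, at n = 10: 196 is
(n + 4)^2 and the factor e^(-1) pays for (minc ((n+1) k) / minc (n k))^n. *)
Lemma minc_step_bound k : 1 / 4 <= k <= 1 ->
  minc (11 * k) <= 196 * expR (2 * rate k - 1) :> R.
Proof.
move=> /andP[k0 k1].
have e14 : expR (14 / 3) <= 112 :> R.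
  have h : expR (14 / 3) ^+ 3 <= 112 ^+ 3 :> R.
    rewrite -expRM_natl (_ : 3%:R * (14 / 3) = 14%:R * 1); last by field.
    rewrite expRM_natl; apply: le_trans (_ : (2719 / 1000) ^+ 14 <= _); last lra.
    by rewrite lerXn2r ?nnegrE ?expR_ge0 ?expR1_le //; lra.
  by rewrite ler_pXn2r ?nnegrE ?expR_ge0 // in h; lra.
have e14' : 112^-1 <= expR (- (14 / 3)) :> R.
  by rewrite expRN lef_pV2 ?posrE ?expR_gt0.
(* At k = 1/4 the rate is - 11/6 and its slope is 41/25; the
smaller slope 7/5 bounds it on the whole interval. *)
have r_ge : 7 / 5 * (k - 1 / 4) <= rate k + 11 / 6.
  have k2 : 0 < 1 + k by lra.
  have -> : rate k + 11 / 6 = (2 * k + k ^+ 2 - 9 / 20 * (1 + k)) / (1 + k).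
    by rewrite /rate; field; rewrite gt_eqF.
  by rewrite ler_pdivlMr //; nra.
have -> : 2 * rate k - 1 = - (14 / 3) + 2 * (rate k + 11 / 6) by field.
rewrite expRD; have h := expR_ge1Dx (2 * (rate k + 11 / 6)).
have h2 : 1 + 14 / 5 * (k - 1 / 4) <= expR (2 * (rate k + 11 / 6)) by lra.
have h3 : 112^-1 * (1 + 14 / 5 * (k - 1 / 4)) <=
    expR (- (14 / 3)) * expR (2 * (rate k + 11 / 6)).
  by apply: ler_pM => //; lra.
by rewrite /minc; lra.
Qed.

Lemma exp_sq_ge (x : R) : 0 <= x -> (1 + x / 2) ^+ 2 <= expR x.
Proof.
move=> x0; have -> : expR x = expR (x / 2) ^+ 2.
  by rewrite -expRM_natl mulrCA mulfV ?mulr1 ?pnatr_eq0.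
by rewrite lerXn2r ?nnegrE ?expR_ge0 ?expR_ge1Dx //; lra.
Qed.

(** Here d = k - 1/4.  The factor 580/227 is the relative slope of
minc (10 k) at k = 1/4, where its value is 227/140; the right-hand side is the
growth of exp (2 rate).  The factor with 28/75 is what the growth of exp
leaves to compensate for the decrease of shape, see base_shape. *)
Lemma base_exp d : 0 <= d -> (1 + 580 / 227 * d) * (1 + 28 / 75 * d) <=
  expR (d * (41 / 10 + 2 * d) / (5 / 4 + d)) :> R.
Proof.
move=> d0; have c0 : 0 < 5 / 4 + d by lra.
set x := d * (41 / 10 + 2 * d) / (5 / 4 + d); have x0 : 0 <= x.
  by apply: divr_ge0; [apply: mulr_ge0 => //; lra | exact: ltW].
apply: le_trans (exp_sq_ge x0).
have -> : (1 + x / 2) ^+ 2 = (5 / 4 + 61 / 20 * d + d ^+ 2) ^+ 2 / (5 / 4 + d) ^+ 2.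
  by rewrite /x; field; apply: lt0r_neq0; lra.
rewrite ler_pdivlMr ?exprn_gt0 //.
have := exprn_ge0 2 d0; have := exprn_ge0 3 d0; have := exprn_ge0 4 d0; lra.
Qed.

(** The quotient of (1 + 4/3 d)^2 by 1 + 4/5 d is the factor by which shape
decreases.  The constant 28/75 makes both sides agree to first order:
8/3 = 4/5 + 5 * 28/75. *)
Lemma base_shape d : 0 <= d ->
  (1 + 4 / 3 * d) ^+ 2 <= (1 + 4 / 5 * d) * (1 + 28 / 75 * d) ^+ 5 :> R.
Proof.
move=> d0; have c0 : 0 <= 28 / 75 * d by lra.
have h := bernoulli2 5 c0; have p0 : 0 <= 1 + 4 / 5 * d by lra.
apply: (le_trans _ (ler_wpM2l p0 h)).
have := exprn_ge0 2 d0; have := exprn_ge0 3 d0; lra.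
Qed.

(** The case n = 10: base_constant settles k = 1/4, and base_exp with
base_shape show that the right-hand side grows faster than the left-hand
side from there on. *)
Lemma minc_base k : 1 / 4 <= k <= 1 ->
  minc (10 * k) ^+ 10 <=
    rho4 R * (13 * 12 * 11 * 10 * 9 * 8 * 7 * 720 * shape k) ^+ 2 *
    expR (2 * rate k) ^+ 10 :> R.
Proof.
move=> /andP[k0 k1]; pose d := k - 1 / 4; have d0 : 0 <= d by rewrite subr_ge0.
have kE : k = d + 1 / 4 by rewrite subrK.
set x := d * (41 / 10 + 2 * d) / (5 / 4 + d).
have rE : 2 * rate k = - (11 / 3) + x.
  by rewrite /rate /x kE; field; do ?[apply/andP; split]; apply: lt0r_neq0; lra.
have mE : minc (10 * k) = minc (5 / 2) * (1 + 580 / 227 * d).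
  by rewrite /minc kE; field.
set P := (1 + 580 / 227 * d) : R in mE *.
set Q := 1 + 28 / 75 * d : R; set S := 1 + 4 / 5 * d : R; set T := 1 + 4 / 3 * d : R.
have P0 : 0 < P by rewrite /P; lra. have Q0 : 0 < Q by rewrite /Q; lra.
have S0 : 0 < S by rewrite /S; lra. have T0 : 0 < T by rewrite /T; lra.
have shE : shape k = 6^-1 * (S / T ^+ 2).
  rewrite /shape /S /T kE; field; do ?[apply/andP; split]; apply: lt0r_neq0; lra.
have PQ : P * Q <= expR x by exact: base_exp.
have TS : T ^+ 2 <= S * Q ^+ 5 by exact: base_shape.
have -> : expR (2 * rate k) ^+ 10 = expR (- (110 / 3)) * expR x ^+ 10.
  rewrite rE expRD exprMn -[expR (- _) ^+ 10]expRM_natl; congr (expR _ * _).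
  by field.
have B := base_constant.
set F : R := 13 * 12 * 11 * 10 * 9 * 8 * 7 * 720 in B *; set E := expR (110 / 3) in B *.
have E0 : 0 < E by rewrite expR_gt0.
rewrite mE shE expRN -/E.
have key : P ^+ 10 <= (S / T ^+ 2) ^+ 2 * expR x ^+ 10.
  have T4 : 0 < T ^+ 4 by rewrite exprn_gt0.
  have -> : (S / T ^+ 2) ^+ 2 = S ^+ 2 / T ^+ 4 by field; rewrite gt_eqF.
  rewrite mulrAC ler_pdivlMr //.
  apply: le_trans (_ : P ^+ 10 * (S * Q ^+ 5) ^+ 2 <= _).
    rewrite ler_wpM2l ?exprn_ge0 ?(ltW P0) //.
    rewrite (exprM T 2 2 : T ^+ 4 = _) lerXn2r ?nnegrE ?exprn_ge0 ?(ltW T0) //.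
    by rewrite mulr_ge0 ?exprn_ge0 // ltW.
  have -> : P ^+ 10 * (S * Q ^+ 5) ^+ 2 = S ^+ 2 * (P * Q) ^+ 10 by ring.
  rewrite ler_wpM2l ?sqr_ge0 // lerXn2r ?nnegrE ?expR_ge0 //.
  by rewrite mulr_ge0 ?ltW.
rewrite exprMn.
have m0 : 0 <= minc (5 / 2) ^+ 10 :> R.
  by apply/exprn_ge0/ltW/minc_gt0; lra.
apply: le_trans (ler_wpM2l m0 key) _.
have -> : rho4 R * (F * (6^-1 * (S / T ^+ 2))) ^+ 2 * (E^-1 * expR x ^+ 10) =
   (rho4 R * F ^+ 2 / (36 * E)) * ((S / T ^+ 2) ^+ 2 * expR x ^+ 10).
  by field; apply/andP; split; apply: lt0r_neq0.
rewrite ler_wpM2r.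
- by [].
- by rewrite mulr_ge0 ?sqr_ge0 ?exprn_ge0 ?expR_ge0.
rewrite ler_pdivlMr ?mulr_gt0 //; apply: le_trans B.
by rewrite mulrA.
Qed.

(** The right-hand factor is the exact growth of permanent_bound^2 when q / n
is kept equal to k; one of the n + 1 factors on the left is bounded by
minc_step_bound, the other n by (1 + 1/n)^n <= e. *)
Lemma minc_growth n k : (10 <= n)%N -> 1 / 4 <= k <= 1 ->
  minc (n.+1%:R * k) ^+ n.+1 <=
  (n%:R + 4) ^+ 2 * expR (2 * rate k) * minc (n%:R * k) ^+ n :> R.
Proof.
move=> n10 k01; have H := minc_step_bound k01; have /andP[k0 k1] := k01.
have N10 : 10 <= n%:R :> R by rewrite ler_nat.
set N := n%:R in N10 *; set g := minc (N * k).
have g0 : 0 < g by apply: minc_gt0; rewrite mulr_ge0 //; lra.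
have gE : minc (n.+1%:R * k) = g + 29 / 70 * k by rewrite /g /minc -natr1 -/N; lra.
pose t := 29 / 70 * k / g; have t0 : 0 <= t by apply: divr_ge0; [lra | exact: ltW].
have pow_le : minc (n.+1%:R * k) ^+ n <= g ^+ n * expR 1.
  have -> : minc (n.+1%:R * k) = g * (1 + t).
    by rewrite gE /t mulrDr mulr1 mulrCA mulfV ?mulr1 // gt_eqF.
  rewrite exprMn ler_wpM2l ?exprn_ge0 ?(ltW g0) //.
  apply: le_trans (_ : expR t ^+ n <= _).
    by rewrite lerXn2r ?nnegrE ?expR_ge0 ?expR_ge1Dx //; lra.
  rewrite -expRM_natl ler_expR -/N /t mulrA ler_pdivrMr // mul1r /g /minc; lra.
have lin_le : minc (n.+1%:R * k) <= (N + 4) ^+ 2 * expR (2 * rate k - 1).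
  set e := expR _ in H *; have e0 : 0 < e by rewrite expR_gt0.
  apply: le_trans (_ : (N + 1) / 11 * (196 * e) <= _).
    apply: le_trans (_ : (N + 1) / 11 * minc (11 * k) <= _).
      by rewrite gE /g /minc; lra.
    by rewrite ler_wpM2l // divr_ge0 //; lra.
  rewrite mulrA ler_wpM2r ?(ltW e0) //; nra.
rewrite exprS; apply: le_trans (ler_pM _ _ lin_le pow_le) _.
- by rewrite ltW // minc_gt0 // mulr_ge0 //; lra.
- by rewrite exprn_ge0 // ltW // minc_gt0 // mulr_ge0 //; lra.
have -> : expR (2 * rate k) = expR (2 * rate k - 1) * expR 1.
  by rewrite -expRD subrK.
by rewrite le_eqVlt; apply/orP; left; apply/eqP; ring.
Qed.

Lemma minc_le_bound n k : (10 <= n)%N -> 1 / 4 <= k <= 1 ->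
  minc (n%:R * k) ^+ n <=
  rho4 R * (((n + 3)`!)%:R * shape k) ^+ 2 * expR (2 * rate k) ^+ n :> R.
Proof.
move=> n10 k01; rewrite -(subnK n10); elim: (n - 10)%N => [|m IH].
  have -> : ((0 + 10 + 3)`!)%:R = 13 * 12 * 11 * 10 * 9 * 8 * 7 * 720 :> R.
    rewrite (_ : (0 + 10 + 3 = 13)%N) //.
    rewrite (factS 12) (factS 11) (factS 10) (factS 9) (factS 8) (factS 7) (factS 6).
    rewrite 7!natrM (_ : 6`! = 720%N) // !mulrA.
    by [].
  exact: minc_base.
set n' := (m + 10)%N in IH *; have n'10 : (10 <= n')%N by rewrite leq_addl.
rewrite addSn; apply: le_trans (minc_growth n'10 k01) _.
have c0 : 0 <= (n'%:R + 4) ^+ 2 * expR (2 * rate k) :> R.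
  by rewrite mulr_ge0 ?sqr_ge0 ?expR_ge0.
apply: le_trans (ler_wpM2l c0 IH) _.
have -> : ((n'.+1 + 3)`!)%:R = (n'%:R + 4) * ((n' + 3)`!)%:R :> R.
  by rewrite addSn factS natrM; congr (_ * _); rewrite -natr1 natrD; ring.
rewrite (exprS (expR _) n') le_eqVlt; apply/orP; left; apply/eqP.
by ring.
Qed.

Theorem minc_le_permanent_bound n q : (10 <= n)%N -> n%:R / 4 <= q <= n%:R ->
  minc q ^+ n <= rho4 R * permanent_bound n q ^+ 2.
Proof.
move=> n10 /andP[q0 q1].
have N10 : 10 <= n%:R :> R by rewrite ler_nat.
set N : R := n%:R in N10 q0 q1; pose k := q / N.
have Nn0 : N != 0 by apply: lt0r_neq0; lra.
have qE : q = N * k by rewrite /k mulrCA mulfV ?mulr1.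
have k01 : 1 / 4 <= k <= 1.
  apply/andP; split; first by rewrite /k ler_pdivlMr; lra.
  by rewrite /k ler_pdivrMr; lra.
have := minc_le_bound n10 k01; rewrite -/N -qE => H; apply: (le_trans H).
rewrite le_eqVlt; apply/orP; left; apply/eqP; rewrite -mulrA; congr (_ * _).
have k_gt0 : 0 < k by case/andP: k01 => ? _; lra.
have N_gt0 : 0 < N by lra.
have -> : permanent_bound n q = ((n + 3)`!)%:R * shape k * expR (rate k) ^+ n.
  rewrite /permanent_bound -/N -expRM_natl -/N; congr (_ * expR _).
    rewrite /shape qE; field.
    by do ?[apply/andP; split]; apply: lt0r_neq0; nra.
  rewrite /rate qE; field.
  by do ?[apply/andP; split]; apply: lt0r_neq0; nra.
by rewrite !exprMn expRM_natl -!exprM mulnC.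
Qed.

End Numeric.

(** * Factorization through C^4 *)
(** The nonzero diagonal entries span an invertible diagonal submatrix. *)
Lemma card_support_diag_mx (F : fieldType) n (d : 'rV[F]_n) :
  (#|[set k | d 0%R k != 0%R]| <= \rank (diag_mx d))%N.
Proof.
set J := [set k | _]; pose f (a : 'I_#|J|) : 'I_n := enum_val a.
pose M := colsub f (rowsub f (diag_mx d)).
have ME : M = diag_mx (\row_a d 0 (f a)).
  apply/matrixP => a b; rewrite !mxE.
  by rewrite (inj_eq enum_val_inj).
have Mu : M \in unitmx.
  rewrite unitmxE ME det_diag unitfE; apply/prodf_neq0 => a _; rewrite mxE.
  by have := enum_valP a; rewrite inE.
have ML : M = rowsub f 1%:M *m diag_mx d *m colsub f 1%:M.
  by rewrite mul_rowsub_mx mul1mx mulmx_colsub mulmx1.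
rewrite -(mxrank_unit Mu) ML.
by apply: leq_trans (mxrankM_maxl _ _) (mxrankM_maxr _ _).
Qed.

Section Factorization.
Local Open Scope sesquilinear_scope.
Variable R : realType.
Local Notation C := (R[i]).

Lemma sum_nth_pad (I : Type) m (s : seq I) (g h : I -> C) : (size s <= m)%N ->
  \sum_(c < m) nth 0 [seq g k | k <- s] c * (nth 0 [seq h k | k <- s] c)^* =
  \sum_(k <- s) g k * (h k)^*.
Proof.
elim: s m => [|a s IH] m sm.
  by rewrite big_nil big1 // => c _; rewrite nth_nil mul0r.
by case: m sm => // m sm; rewrite big_ord_recl big_cons IH.
Qed.

(** Diagonalise A unitarily and keep the coordinates along the at most four
nonzero eigenvalues, padding with zeros. *)
Lemma psd_factor n (A : 'M[C]_n) : psdmx A -> (\rank A <= 4)%N ->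
  exists V : 'I_n -> 'I_4 -> C, forall i j, A i j = dotc (V i) (V j).
Proof.
move=> [Aherm Apos] rA.
have /orthomx_spectralP AE := hermitian_normalmx Aherm.
set P := spectralmx A in AE; set d := spectral_diag A in AE.
have Pu : P \is unitarymx by exact: spectral_unitarymx.
have Punit : P \in unitmx by exact: unitarymx_unit.
rewrite invmx_unitary // in AE.
have PPt : P *m P^t* = 1%:M by exact/unitarymxP.
have PAP : P *m A *m P^t* = diag_mx d.
  by rewrite AE !mulmxA PPt mul1mx -mulmxA PPt mulmx1.
have d_ge0 k : 0 <= d 0 k.
  have := Apos ((row k P)^t*); rewrite trmxCK -row_mul.
  suff -> : (row k (P *m A) *m (row k P)^t*) 0 0 = d 0 k by [].
  have := congr1 (fun M : 'M_n => M k k) PAP.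
  rewrite [X in _ = X]mxE eqxx mulr1n => <-.
  by rewrite !mxE; apply: eq_bigr => l _; rewrite !mxE.
pose s := enum [set k | d 0 k != 0].
pose g i k : C := sqrtC (d 0 k) * (P k i)^*.
have s4 : (size s <= 4)%N.
  rewrite -cardE; apply: leq_trans (card_support_diag_mx d) _.
  by rewrite -PAP; apply: leq_trans rA; apply: leq_trans (mxrankM_maxl _ _) (mxrankM_maxr _ _).
exists (fun i c => nth 0 [seq g i k | k <- s] c) => i j.
rewrite /dotc sum_nth_pad // big_enum /=.
transitivity (\sum_k g i k * (g j k)^*); last first.
  rewrite [RHS]big_mkcond; apply: eq_bigr => k _; rewrite inE.
  by case: eqP => // dk; rewrite /g dk sqrtC0 !mul0r.
rewrite {1}AE mxE; apply: eq_bigr => k _.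
rewrite mul_mx_diag !mxE /g rmorphM /= conjCK.
have sqr : sqrtC (d 0 k) * (sqrtC (d 0 k))^* = d 0 k.
  rewrite (@conj_Creal _ (sqrtC (d 0 k))) ?ger0_real ?sqrtC_ge0 //.
  by rewrite -expr2 sqrtCK.
by rewrite -[in LHS]sqr; ring.
Qed.

End Factorization.

(** * The permanent inequality *)
Section Main.
Variable R : realType.
Local Notation C := (R[i]).

Lemma rho4_ge0 : 0 <= rho4 R.
Proof. by rewrite /rho4; lra. Qed.

Lemma rho4_complex : rho4 C = (rho4 R)%:C%C.
Proof.
have cn k : (k%:R)%:C%C = k%:R :> C by exact: (rmorph_nat (real_complex R)).
have cX k m : ((k%:R) ^+ m)%:C%C = k%:R ^+ m :> C by rewrite rmorphXn /= cn.
have cMX k l m : (k%:R * (l%:R) ^+ m)%:C%C = k%:R * l%:R ^+ m :> C.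
  by rewrite rmorphM /= cn cX.
rewrite /rho4 fmorph_div /= cX; congr (_ / _).
by rewrite 3!rmorphD /= !cMX (cMX 742%N 1000%N 1%N) cn.
Qed.

Lemma permanent_hermitian_real n (A : 'M[C]_n) :
  (forall i j, A j i = (A i j)^*) ->
  permanent A = (complex.Re (permanent A))%:C%C.
Proof.
move=> hA; apply/esym/RRe_real/CrealP.
rewrite -(map_permanent (@Num.conj C)) -permanent_tr; congr permanent.
by apply/matrixP => i j; rewrite !mxE; exact/esym/hA.
Qed.

Lemma unit_gram_bound n (u : 'I_n -> 'I_4 -> C) : (10 <= n)%N ->
  (forall i, dotc (u i) (u i) = 1) ->
  let g := complex.Re (permanent (gram u)) in
  0 < g /\ permanent (\matrix_(i, j) overlap u i j) <= rho4 R * g ^+ 2.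
Proof.
move=> n10 u1 g; have n0 : (0 < n)%N by lia.
have N0 : 0 < n%:R :> R by rewrite ltr0n.
set q := total2 u / n%:R.
have q_ge : n%:R / 4 <= q.
  rewrite /q ler_pdivlMr // mulrAC ler_pdivrMr // mulrC -expr2.
  by have := total2_ge u1; rewrite mulrC.
have q_le : q <= n%:R by rewrite /q ler_pdivrMr // -expr2 total2_le.
have q0 : 0 < q by apply: lt_le_trans q_ge; rewrite divr_gt0.
have L : permanent_bound n q <= g by apply: permanent_gram_ge => //; lia.
have B0 : 0 < permanent_bound n q.
  apply: mulr_gt0; last exact: expR_gt0.
  apply: divr_gt0; last by apply: exprn_gt0; lra.
  by apply: mulr_gt0; [apply: mulr_gt0; [rewrite ltr0n fact_gt0 | lra] | apply: mulr_gt0; lra].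
split; first exact: lt_le_trans L.
apply: le_trans (permanent_le_minc_mean n0 _) _.
  by move=> i j; rewrite mxE nsq_ge0 overlap_le1.
have -> : (\sum_i \sum_j (\matrix_(i, j) overlap u i j) i j) / n%:R = q.
  by congr (_ / _); apply: eq_bigr => i _; apply: eq_bigr => j _; rewrite mxE.
apply: le_trans (minc_le_permanent_bound n10 _) _; first by rewrite q_ge q_le.
rewrite ler_wpM2l ?rho4_ge0 // lerXn2r ?nnegrE ?(ltW B0) //.
exact: le_trans (ltW B0) L.
Qed.

(** Both permanents of a single matrix are exhibited as real numbers p and c, so
that the remaining comparisons take place in R. *)
Lemma psd_permanents n (A : 'M[C]_n) : (10 <= n)%N -> psdmx A -> (\rank A <= 4)%N ->
  exists p c : R, [/\ permanent A = p%:C%C,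
    permanent (hadamard A (map_mx Num.conj A)) = c%:C%C,
    0 <= p, 0 <= c <= rho4 R * p ^+ 2 &
    ((exists i, A i i = 0) -> p = 0 /\ c = 0) /\
    ((forall i, 0 < A i i) -> 0 < p)].
Proof.
move=> n10 psdA rA; have [V VE] := psd_factor psdA rA.
pose w i : R := \sum_k nsq (V i k).
have AiiE i : A i i = (w i)%:C%C.
  rewrite VE rmorph_sum; apply: eq_bigr => k _; exact/esym/nsqE.
have w_ge0 i : 0 <= w i by apply: sumr_ge0 => k _; exact: nsq_ge0.
have [/existsP[i /eqP wi0]|] := boolP [exists i, w i == 0].
  have Vi k : V i k = 0.
    have : nsq (V i k) == 0.
      move/eqP: wi0; rewrite psumr_eq0 => [/allP/(_ k)|k' _]; last exact: nsq_ge0.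
      by rewrite mem_index_enum => /(_ isT).
    by move=> /eqP nk; apply/eqP; rewrite -normr_eq0 -sqrf_eq0 normCK -nsqE nk.
  have A0 j : A i j = 0 by rewrite VE /dotc big1 // => k _; rewrite Vi mul0r.
  exists 0, 0; split => //.
  - exact: (permanent_row0 A0).
  - by apply: (@permanent_row0 _ _ _ i) => j; rewrite mxE A0 mul0r.
  - by rewrite expr0n mulr0 lexx.
  by split => // /(_ i); rewrite A0 ltxx.
move=> /existsPn wn0; have w_gt0 i : 0 < w i by rewrite lt_def wn0 w_ge0.
(* Normalising the vectors divides permanent A by p = prod_i w i and the
permanent of the Hadamard product by p^2. *)
pose u i k : C := (Num.sqrt (w i))^-1%:C%C * V i k.
have cr (r : R) : (r%:C%C)^* = r%:C%C :> C.
  by apply: conj_Creal; apply/complex_realP; exists r.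
have s_neq0 i : Num.sqrt (w i) != 0 by rewrite gt_eqF // sqrtr_gt0.
have uV i j : dotc (u i) (u j) =
    ((Num.sqrt (w i))^-1)%:C%C * dotc (V i) (V j) * ((Num.sqrt (w j))^-1)%:C%C.
  rewrite /dotc mulr_sumr mulr_suml; apply: eq_bigr => k _.
  by rewrite /u rmorphM /= cr; ring.
have u1 i : dotc (u i) (u i) = 1.
  rewrite uV -VE AiiE -!rmorphM /= -[X in _ * X * _](sqr_sqrtr (w_ge0 i)).
  by rewrite expr2 mulKf // divff.
have AE i j : A i j = (Num.sqrt (w i))%:C%C * dotc (u i) (u j) * (Num.sqrt (w j))%:C%C.
  rewrite uV -VE !mulrA -rmorphM /= mulfV // rmorph1 mul1r -mulrA -rmorphM /=.
  by rewrite mulVf // rmorph1 mulr1.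
have [g_gt0 perC] := unit_gram_bound n10 u1.
set g := complex.Re _ in g_gt0 perC.
set c0 := permanent _ in perC.
pose p := \prod_i w i; have p_gt0 : 0 < p by apply: prodr_gt0.
have prod_sqrt : (\prod_i Num.sqrt (w i)) ^+ 2 = p.
  by rewrite -prodrXl; apply: eq_bigr => i _; rewrite sqr_sqrtr.
exists (p * g), (p ^+ 2 * c0); split.
- have -> : A = \matrix_(i, j) ((Num.sqrt (w i))%:C%C * gram u i j * (Num.sqrt (w j))%:C%C).
    by apply/matrixP => i j; rewrite !mxE.
  have gH i j : gram u j i = (gram u i j)^* by rewrite !mxE -dotcC.
  rewrite permanent_scale (permanent_hermitian_real gH) -/g -!rmorph_prod -!rmorphM /=.
  by congr (_%:C)%C; rewrite -prod_sqrt; ring.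
- have -> : hadamard A (map_mx Num.conj A) =
      map_mx (real_complex R) (\matrix_(i, j) (w i * (\matrix_(i, j) overlap u i j) i j * w j)).
    apply/matrixP => i j; rewrite !mxE !rmorphM /= overlapE (dotcC (u i) (u j)).
    rewrite [A i j]AE !rmorphM /= !cr.
    rewrite -[in RHS](sqr_sqrtr (w_ge0 i)) -[in RHS](sqr_sqrtr (w_ge0 j)).
    by rewrite !rmorphXn /=; ring.
  rewrite map_permanent permanent_scale -/c0 /=.
  by congr (_%:C)%C; rewrite -/p; ring.
- by rewrite mulr_ge0 ?ltW.
- rewrite exprMn mulrCA ler_wpM2l ?sqr_ge0 // andbT mulr_ge0 ?sqr_ge0 //.
  apply: sumr_ge0 => s _; apply: prodr_ge0 => i _.
  by rewrite mxE nsq_ge0.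
split; last by rewrite mulr_gt0.
move=> [k]; rewrite AiiE => /complexI wk0.
by have := w_gt0 k; rewrite wk0 ltxx.
Qed.

(** Cauchy-Schwarz over the symmetric group. *)
Lemma nsq_permanent_hadamard n (A B : 'M[C]_n) (a b : R) :
  permanent (hadamard A (map_mx Num.conj A)) = a%:C%C ->
  permanent (hadamard B (map_mx Num.conj B)) = b%:C%C ->
  nsq (permanent (hadamard A B)) <= a * b.
Proof.
have E (M : 'M[C]_n) : permanent (hadamard M (map_mx Num.conj M)) =
    (\sum_(s : 'S_n) nsq (\prod_i M i (s i)))%:C%C.
  rewrite /permanent rmorph_sum; apply: eq_bigr => s _.
  rewrite [RHS]nsqE rmorph_prod -big_split /=.
  by apply: eq_bigr => i _; rewrite !mxE.
rewrite !E => /complexI <- /complexI <-.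
have -> : permanent (hadamard A B) =
    \sum_(s : 'S_n) (\prod_i A i (s i)) * \prod_i B i (s i).
  apply: eq_bigr => s _; rewrite -big_split /=.
  by apply: eq_bigr => i _; rewrite mxE.
exact: complex_CS.
Qed.

End Main.

Theorem theorem1p2 (R : realType) (n : nat) (hn : (10 <= n)%N) :
  rho4 R < 1
  /\ (forall A : 'M[R[i]]_n, psdmx A -> (\rank A <= 4)%N ->
        permanent (hadamard A (map_mx Num.conj A)) <= rho4 R[i] * permanent A ^+ 2
        /\ ((exists i : 'I_n, A i i = 0) ->
              permanent (hadamard A (map_mx Num.conj A)) = 0 /\ permanent A ^+ 2 = 0)
        /\ ((forall i : 'I_n, 0 < A i i) -> 0 < permanent A))
  /\ (forall A B : 'M[R[i]]_n, psdmx A -> psdmx B ->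
        (\rank A <= 4)%N -> (\rank B <= 4)%N ->
        permanent (hadamard A B) <= rho4 R[i] * permanent A * permanent B).
Proof.
split; first by rewrite /rho4; lra.
split=> [A psdA rA|A B psdA psdB rA rB].
  have [p [c [-> -> p0 /andP[_ cp] [z pos]]]] := psd_permanents hn psdA rA.
  split; last split.
  - by rewrite rho4_complex -rmorphXn -rmorphM /= lecR.
  - by move=> /z[-> ->]; rewrite rmorph0 expr0n.
  - by move=> /pos; rewrite ltcR.
have [p [c [-> cE p0 /andP[c0 cp] _]]] := psd_permanents hn psdA rA.
have [q [d [-> dE q0 /andP[d0 dq] _]]] := psd_permanents hn psdB rB.
have [V VE] := psd_factor psdA rA; have [W WE] := psd_factor psdB rB.
have herm i j : hadamard A B j i = (hadamard A B i j)^*.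
  by rewrite !mxE rmorphM /= !VE !WE -!dotcC.
have := nsq_permanent_hadamard cE dE.
rewrite (permanent_hermitian_real herm) nsq_real.
set r := complex.Re _ => rr; rewrite rho4_complex -!rmorphM /= lecR.
have b0 : 0 <= rho4 R * p * q.
  by apply: mulr_ge0 => //; apply: mulr_ge0 => //; exact: rho4_ge0.
apply: le_trans (ler_norm r) _.
suff h : `|r| ^+ 2 <= (rho4 R * p * q) ^+ 2 by rewrite ler_pXn2r ?nnegrE in h.
rewrite real_normK ?num_real //; apply: (le_trans rr).
have -> : (rho4 R * p * q) ^+ 2 = (rho4 R * p ^+ 2) * (rho4 R * q ^+ 2) by ring.
by apply: ler_pM.
Qed.
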